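(* For every integer $r>2$, the search problem weak-Turán$_r$ belongs to $\mathsf{PPP}$.
   Context: Search problems. A search problem is a binary relation $R\subseteq\{0,1\}^*\times\{0,1\}^*$; $s$ is a solution of instance $x$ if $(x,s)\in R$. It is total if every instance has a solution. $\mathsf{TFNP}$ is the class of total search problems whose relation is decidable in deterministic polynomial time and in which every instance has a solution of length polynomial in the instance size. Problems are specified by their valid (polynomial-time recognizable) instances; for an invalid instance every string is a solution by convention. $R$ is (polynomial-time) reducible to $S$ if there are polynomial-time functions $f,g$ such that for all $x,s$: if $s$ is a solution of $f(x)$ for $S$ then $g(x,s)$ is a solution of $x$ for $R$. Pigeon: an instance is a Boolean circuit $C:\{0,1\}^n\to\{0,1\}^{n}$; a solution is either $x$ with $C(x)=0^n$ or a pair $x\ne y$ with $C(x)=C(y)$. $\mathsf{PPP}$ is the class of all $\mathsf{TFNP}$ problems reducible to Pigeon. weak-Turán$_r$ ($r$ a fixed constant): an instance is a Boolean circuit $C:\{0,1\}^{2n-1}\to\{0,1\}^n\times\{0,1\}^n$ ($n$ a positive integer, part of the instance); $C(i)=(u,v)$ is viewed as the edge between $u$ and $v$ in a graph with vertex set $\{0,1\}^n$. A solution is one of: (i) distinct $i_1,\dots,i_{r(r+1)/2}$ such that $C(i_1),\dots,C(i_{r(r+1)/2})$ are the edges of an $(r+1)$-clique; (ii) $i$ such that $C(i)=(u,v)$ with $u\ge v$ in the lexicographic order; (iii) $i\ne j$ such that $C(i)=C(j)$. *)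

(* Defs.v *)
From HB Require Import structures.
From mathcomp Require Import all_boot all_order all_algebra.

Set Implicit Arguments.
Unset Strict Implicit.
Unset Printing Implicit Defensive.

Notation word := (seq bool).

(** * Polynomial time: deterministic multi-tape Turing machines *)

(* [None] is the blank symbol. *)
Notation symbol := (option bool).

Variant move := MoveLeft | Stay | MoveRight.

(* A tape is infinite in both directions.  The first list holds the cells to
   the left of the head, nearest first; the second one holds the scanned cell
   and the cells to its right; all the cells beyond the lists are blank. *)
Definition tape : Type := (seq symbol * seq symbol)%type.

Definition read (t : tape) : symbol := head None t.2.

Definition write_move (a : symbol) (m : move) (t : tape) : tape :=
  let: (l, r) := t in
  match m with
  | MoveLeft => (behead l, head None l :: a :: behead r)
  | Stay => (l, a :: behead r)
  | MoveRight => (a :: l, behead r)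
  end.

(* The machine has [last_tape.+1] tapes, so that there is a tape 0.
   The value [None] of [delta] means that the machine halts. *)
Record machine := Machine {
  state : finType;
  last_tape : nat;
  start : state;
  delta : state -> {ffun 'I_last_tape.+1 -> symbol} ->
            option (state * {ffun 'I_last_tape.+1 -> symbol * move})
}.

Definition config (M : machine) : Type :=
  (state M * {ffun 'I_(last_tape M).+1 -> tape})%type.

Definition step (M : machine) (c : config M) : option (config M) :=
  let: (q, ts) := c in
  if delta q [ffun i => read (ts i)] is Some (q', act) then
    Some (q', [ffun i => write_move (act i).1 (act i).2 (ts i)])
  else None.

Fixpoint run (M : machine) (n : nat) (c : config M) : config M :=
  if n is n'.+1 then
    if step c is Some c' then run n' c' else c
  else c.

(* The [i]-th input word is on tape [i], with the head on its first letter;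
   the other tapes are blank. *)
Definition init (M : machine) (xs : seq word) : config M :=
  (start M, [ffun i : 'I_(last_tape M).+1 => ([::], map some (nth [::] xs i))]).

Fixpoint word_of_cells (r : seq symbol) : word :=
  if r is Some b :: r' then b :: word_of_cells r' else [::].

(* The output word starts at the head of tape 0 and ends before the first
   blank. *)
Definition output (M : machine) (c : config M) : word :=
  word_of_cells (c.2 ord0).2.

Definition outputs_within (M : machine) (xs : seq word) (y : word) (t : nat) :
    Prop :=
  let c := run t (init M xs) in step c = None /\ output c = y.

Definition polytime1 (f : word -> word) : Prop :=
  exists (M : machine) (p : {poly nat}), forall x : word,
    outputs_within M [:: x] (f x) (p.[size x])%R.

Definition polytime2 (g : word -> word -> word) : Prop :=
  exists (M : machine) (p : {poly nat}), forall x s : word,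
    outputs_within M [:: x; s] (g x s) (p.[size x + size s])%R.

(** * Search problems *)

(* [R x s]: [s] is a solution of the instance [x]. *)
Definition search_problem := word -> word -> Prop.

Definition polytime_decidable (R : search_problem) : Prop :=
  exists d : word -> word -> bool,
    (forall x s, R x s <-> d x s) /\
    polytime2 (fun x s => [:: d x s]).

Definition TFNP (R : search_problem) : Prop :=
  polytime_decidable R /\
  exists p : {poly nat}, forall x : word,
    exists2 s : word, R x s & size s <= (p.[size x])%R.

Definition reducible (R S : search_problem) : Prop :=
  exists (f : word -> word) (g : word -> word -> word),
    [/\ polytime1 f, polytime2 g &
        forall x s : word, S (f x) s -> R x (g x s)].

(** * Boolean circuits *)

(* A circuit is a straight-line program.  Its wires are numbered: first the
   inputs, then the gates in order, each gate reading earlier wires only. *)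
Variant gate :=
  | Const of bool
  | Not of nat
  | And of nat & nat
  | Or of nat & nat.

Record circuit := Circuit {
  inputs : nat;
  gates : seq gate;
  outputs : seq nat
}.

Definition gate_ok (w : nat) (g : gate) : bool :=
  match g with
  | Const _ => true
  | Not i => i < w
  | And i j | Or i j => (i < w) && (j < w)
  end.

Fixpoint gates_ok (w : nat) (gs : seq gate) : bool :=
  if gs is g :: gs' then gate_ok w g && gates_ok w.+1 gs' else true.

(* [C] is a well-formed circuit from [{0,1}^m] to [{0,1}^k]. *)
Definition is_circuit (m k : nat) (C : circuit) : bool :=
  [&& inputs C == m, size (outputs C) == k, gates_ok m (gates C) &
      all (fun j => j < m + size (gates C)) (outputs C)].

Definition gate_value (vs : seq bool) (g : gate) : bool :=
  match g with
  | Const b => b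
  | Not i => ~~ nth false vs i
  | And i j => nth false vs i && nth false vs j
  | Or i j => nth false vs i || nth false vs j
  end.

Definition eval (C : circuit) (x : word) : word :=
  let vs := foldl (fun vs g => rcons vs (gate_value vs g)) x (gates C) in
  [seq nth false vs j | j <- outputs C].

(* Numbers are written in unary.  The inputs are vertices of the circuit and
   a wire number is smaller than the number of vertices, so that this changes
   the size of a circuit at most polynomially. *)
Definition encode_nat (n : nat) : word := nseq n true ++ [:: false].

Definition encode_seq (T : Type) (e : T -> word) (s : seq T) : word :=
  foldr (fun a w => true :: e a ++ w) [:: false] s.

Definition encode_gate (g : gate) : word :=
  match g with
  | Const b => [:: false; false; b]
  | Not i => [:: false; true] ++ encode_nat i
  | And i j => [:: true; false] ++ encode_nat i ++ encode_nat j
  | Or i j => [:: true; true] ++ encode_nat i ++ encode_nat j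
  end.

Definition encode_circuit (C : circuit) : word :=
  encode_nat (inputs C) ++ encode_seq encode_gate (gates C) ++
  encode_seq encode_nat (outputs C).

Definition prefix_code (T : Type) (e : T -> word) : Prop :=
  forall a a' w w', e a ++ w = e a' ++ w' -> a = a' /\ w = w'.

Lemma encode_nat_prefix_code : prefix_code encode_nat.
Proof.
by elim=> [|n IHn] [|n'] w w' //= [] => [|/IHn[-> ->]].
Qed.

Lemma encode_seq_prefix_code (T : Type) (e : T -> word) :
  prefix_code e -> prefix_code (encode_seq e).
Proof.
move=> e_code; elim=> [|a s IHs] [|a' s'] w w' //= [] => [-> //|].
by rewrite -!catA => /e_code[-> /IHs[-> ->]].
Qed.

Lemma encode_gate_prefix_code : prefix_code encode_gate.
Proof.
move=> [b|i|i j|i j] [b'|i'|i' j'|i' j'] w w' //= [].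
- by move=> -> ->.
- by move/encode_nat_prefix_code=> [-> ->].
- rewrite -!(catA (encode_nat _)).
  by move/encode_nat_prefix_code=> [-> /encode_nat_prefix_code[-> ->]].
- rewrite -!(catA (encode_nat _)).
  by move/encode_nat_prefix_code=> [-> /encode_nat_prefix_code[-> ->]].
Qed.

Lemma encode_circuit_inj : injective encode_circuit.
Proof.
move=> [m gs os] [m' gs' os']; rewrite /encode_circuit /=.
move/encode_nat_prefix_code=> [<-].
move/(encode_seq_prefix_code encode_gate_prefix_code)=> [<- eq_os].
have [|<- //] := @encode_seq_prefix_code _ _ encode_nat_prefix_code
  os os' [::] [::].
by rewrite !cats0.
Qed.

(** * Pigeon and PPP *)

(* A solution made of several strings of the same length [m] is encoded by
   their concatenation. *)
Definition encodes_solution (m : nat) (s : word) (xs : seq word) : Prop :=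
  s = flatten xs /\ all (fun x => size x == m) xs.

Definition pigeon_solution (n : nat) (C : circuit) (xs : seq word) : Prop :=
  (exists2 x, xs = [:: x] & eval C x = nseq n false) \/
  (exists x y, [/\ xs = [:: x; y], x <> y & eval C x = eval C y]).

(* The words that encode no circuit from [{0,1}^n] to [{0,1}^n] are the
   invalid instances: every word solves them. *)
Definition pigeon : search_problem := fun inst s =>
  forall (n : nat) (C : circuit),
    is_circuit n n C -> encode_circuit C = inst ->
  exists2 xs, encodes_solution n s xs & pigeon_solution n C xs.

Definition PPP (R : search_problem) : Prop :=
  TFNP R /\ reducible R pigeon.

(** * The problem weak-Turán *)

Definition edge (n : nat) (C : circuit) (i : word) : word * word :=
  (take n (eval C i), drop n (eval C i)).

(* [es] lists the edges of a complete graph on [k] vertices, each edge being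
   given with an arbitrary orientation.  When [es] has as many elements as
   there are edges, none of them is listed twice. *)
Definition edges_of_clique (k : nat) (es : seq (word * word)) : Prop :=
  exists K : seq word,
    [/\ uniq K, size K = k,
        forall e, e \in es -> [&& e.1 \in K, e.2 \in K & e.1 != e.2] &
        forall u v, u \in K -> v \in K -> u != v ->
          ((u, v) \in es) || ((v, u) \in es)].

Definition weak_turan_solution (r n : nat) (C : circuit) (xs : seq word) :
    Prop :=
  [\/ [/\ size xs = (r * r.+1) %/ 2, uniq xs &
          edges_of_clique r.+1 (map (edge n C) xs)],
      exists2 i, xs = [:: i] &
        ((edge n C i).1 >= (edge n C i).2 :> seqlexi bool)%O |
      exists i j, [/\ xs = [:: i; j], i <> j & edge n C i = edge n C j]].

Definition weak_turan (r : nat) : search_problem := fun inst s =>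
  forall (n : nat) (C : circuit),
    0 < n -> is_circuit (2 * n - 1) (2 * n) C -> encode_circuit C = inst ->
  exists2 xs, encodes_solution (2 * n - 1) s xs &
              weak_turan_solution r n C xs.

(* Main.v *)
(** The edges [u < v] of the complete graph on [2^n] vertices are fewer than
    [2^(2n-1)].  Folding the square of pairs by its point reflection, i.e.
    complementing both [u] and [v] when the first bit of [u] is 1 and then
    dropping that bit, maps pairs of [n]-bit words to words of [2n - 1] bits.  It is
    2-to-1, the other preimage of a pair being its complement, which reverses
    the order: hence it is injective on the pairs [u < v], and it sends none of
    them to zero.  Appended to the outputs of a weak-Turán instance it yields a
    Pigeon instance.  A zero is a pair [u = v]; in a collision, either the two
    edges are equal or one of the two inputs gives [u >= v], and a decision
    procedure for weak-Turán tells which.  The same counting shows totality, and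
    a clique is found by trying all the [r.+1]-tuples of endpoints of the
    constantly many edges.

    Polynomial time is obtained from stack programs, each tape being a stack.
    [PT f] says that such programs, generated for any choice of registers,
    compute [f] between types stored in registers; this class is closed under
    composition, pairing, conditionals and folds over words whose intermediate
    states are polynomially bounded. *)

Require Import Defs.
From mathcomp Require Import all_boot all_order all_algebra zify.

Set Implicit Arguments.
Unset Strict Implicit.
Unset Printing Implicit Defensive.

(** * Structured programs on stacks *)

(** Since polynomial time is stated for concrete machines, every algorithm used has to be exhibited
    as code with a clock. This dictates their shape: apart from constant-size combinations, each is
    one left-to-right [foldl] over a word with a small record as state. The unary encoding suits
    such folds: a wire is looked up by popping a copy of the stack of wires, and since a gate reads
    only earlier wires, a circuit is parsed, checked and evaluated in a single pass.

    The programs have no procedures and address fixed registers, so a function is represented by a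
    code generator, run afresh on disjoint registers at each use.

    On circuits, folding an edge means xoring the first output with each other output, four gates
    apiece. The [2n] outputs lose one, which leaves as many as there are inputs. The reduction
    writes these gates while it reads the outputs, again in one pass.

    The way back receives only a word, without knowing whether it is one string or two glued
    together; instead of parsing it, it tests candidate answers with the decision procedure that
    membership in TFNP requires anyway. *)

Inductive prog :=
  | Skip
  | Push of bool & nat
  | Pop of nat
  | Seq of prog & prog
  | Case of nat & prog & prog & prog
  | While of nat & prog.

Definition regs := nat -> word.

Definition upd (s : regs) (i : nat) (w : word) : regs :=
  fun j => if j == i then w else s j.

(** The clock counts exactly the steps of the compiled machine: a push is a move followed by a
    write, [Seq] pays one step of handover, and a loop pays one to enter its body and one to come
    back. *)
Inductive exec : prog -> regs -> regs -> nat -> Prop :=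
  | ExecSkip s : exec Skip s s 0
  | ExecPush b i s : exec (Push b i) s (upd s i (b :: s i)) 2
  | ExecPop i s : exec (Pop i) s (upd s i (behead (s i))) 1
  | ExecSeq p q s1 s2 s3 t u :
      exec p s1 s2 t -> exec q s2 s3 u -> exec (Seq p q) s1 s3 (t + u).+1
  | ExecCaseNil i p q r s s' t :
      s i = [::] -> exec p s s' t -> exec (Case i p q r) s s' t.+1
  | ExecCaseTrue i p q r s s' t w :
      s i = true :: w -> exec q s s' t -> exec (Case i p q r) s s' t.+1
  | ExecCaseFalse i p q r s s' t w :
      s i = false :: w -> exec r s s' t -> exec (Case i p q r) s s' t.+1
  | ExecWhileStop i p s : s i = [::] -> exec (While i p) s s 0
  | ExecWhileStep i p s1 s2 s3 t u :
      s1 i != [::] -> exec p s1 s2 t -> exec (While i p) s2 s3 u ->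
      exec (While i p) s1 s3 (t + u).+2.

Fixpoint max_reg (p : prog) : nat :=
  match p with
  | Skip => 0
  | Push _ i | Pop i => i
  | Seq p q => maxn (max_reg p) (max_reg q)
  | Case i p q r => maxn i (maxn (max_reg p) (maxn (max_reg q) (max_reg r)))
  | While i p => maxn i (max_reg p)
  end.

(** * Compilation to Turing machines *)

Section Compile.

Variable k : nat.

Notation scanned := {ffun 'I_k.+1 -> symbol}.
Notation action := {ffun 'I_k.+1 -> symbol * move}.
Notation tapes := {ffun 'I_k.+1 -> tape}.

(** With the number of tapes fixed once for all, combining machines is an operation on their state
    spaces alone. *)
Record submachine := Submachine {
  sub_state : finType;
  sub_start : sub_state;
  sub_delta : sub_state -> scanned -> option (sub_state * action)
}.

Definition machine_of (M : submachine) : machine :=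
  @Machine (sub_state M) k (sub_start M) (@sub_delta M).

Definition idle (v : scanned) : action := [ffun i => (v i, Stay)].

Definition act_on (i : nat) (a : symbol) (m : move) (v : scanned) : action :=
  [ffun j : 'I_k.+1 => if j == i :> nat then (a, m) else (v j, Stay)].

Definition skip_machine : submachine := @Submachine unit tt (fun _ _ => None).

(** A machine writes before it moves, so the scanned letter is first rewritten while the head steps
    left, and [b] is then written in place. *)
Definition push_machine (b : bool) (i : nat) : submachine :=
  @Submachine (option bool) None (fun q v =>
    match q with
    | None => Some (Some false, act_on i (v (inord i)) MoveLeft v)
    | Some false => Some (Some true, act_on i (Some b) Stay v)
    | Some true => None
    end).

Definition pop_machine (i : nat) : submachine :=
  @Submachine bool false (fun q v =>
    if q then None else Some (true, act_on i None MoveRight v)).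

Definition map_state (S S' : finType) (h : S -> S') (x : option (S * action)) :
    option (S' * action) :=
  if x is Some (q, a) then Some (h q, a) else None.

Definition seq_machine (M N : submachine) : submachine :=
  @Submachine (sub_state M + sub_state N)%type (inl (sub_start M))
    (fun q v => match q with
      | inl q => if sub_delta q v is Some (q', a) then Some (inl q', a)
                 else Some (inr (sub_start N), idle v)
      | inr q => map_state inr (sub_delta q v)
      end).

Definition case_machine (i : nat) (M N L : submachine) : submachine :=
  @Submachine (option (sub_state M + (sub_state N + sub_state L)))%type None
    (fun q v => match q with
      | None => Some (Some match v (inord i) with
          | None => inl (sub_start M)
          | Some true => inr (inl (sub_start N))
          | Some false => inr (inr (sub_start L))
          end, idle v)
      | Some (inl q) => map_state (Some \o inl) (sub_delta q v)
      | Some (inr (inl q)) => map_state (Some \o (inr \o inl)) (sub_delta q v)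
      | Some (inr (inr q)) => map_state (Some \o (inr \o inr)) (sub_delta q v)
      end).

Definition while_machine (i : nat) (M : submachine) : submachine :=
  @Submachine (option (sub_state M)) None
    (fun q v => match q with
      | None => if v (inord i) is Some _ then Some (Some (sub_start M), idle v)
                else None
      | Some q => if sub_delta q v is Some (q', a) then Some (Some q', a)
                  else Some (None, idle v)
      end).

Fixpoint compile (p : prog) : submachine :=
  match p with
  | Skip => skip_machine
  | Push b i => push_machine b i
  | Pop i => pop_machine i
  | Seq p q => seq_machine (compile p) (compile q)
  | Case i p q r => case_machine i (compile p) (compile q) (compile r)
  | While i p => while_machine i (compile p)
  end.

Definition sub_step (M : submachine) (q : sub_state M) (ts : tapes) :
    option (sub_state M * tapes) :=
  step (M := machine_of M) (q, ts).

Definition act_tapes (a : action) (ts : tapes) : tapes :=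
  [ffun i => write_move (a i).1 (a i).2 (ts i)].

Definition scan_tapes (ts : tapes) : scanned := [ffun i => read (ts i)].

Lemma sub_stepE M (q : sub_state M) ts : sub_step q ts =
  if sub_delta q (scan_tapes ts) is Some (q', a) then Some (q', act_tapes a ts)
  else None.
Proof. by []. Qed.

Inductive steps (M : submachine) :
    nat -> sub_state M -> tapes -> sub_state M -> tapes -> Prop :=
  | Steps0 q ts : steps 0 q ts q ts
  | StepsS n q1 ts1 q2 ts2 q3 ts3 :
      sub_step q1 ts1 = Some (q2, ts2) -> steps n q2 ts2 q3 ts3 ->
      steps n.+1 q1 ts1 q3 ts3.

Lemma steps_trans M m n (q1 q2 q3 : sub_state M) ts1 ts2 ts3 :
  steps m q1 ts1 q2 ts2 -> steps n q2 ts2 q3 ts3 ->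
  steps (m + n) q1 ts1 q3 ts3.
Proof.
elim=> [//|{}m {}q1 {}ts1 q {}ts q' ts' step1 _ IH] /IH steps2.
exact: StepsS step1 steps2.
Qed.

(** Only genuine steps are simulated: where [M] halts, the composite machine may go on. *)
Lemma steps_sim M N (h : sub_state M -> sub_state N) n q ts q' ts' :
  (forall q1 ts1 q2 ts2, sub_step q1 ts1 = Some (q2, ts2) ->
     sub_step (h q1) ts1 = Some (h q2, ts2)) ->
  steps n q ts q' ts' -> steps n (h q) ts (h q') ts'.
Proof.
move=> sim; elim=> [|m q1 ts1 q2 ts2 q3 ts3 /sim step1 _ IH]; first by move=> *; exact: Steps0.
exact: StepsS step1 IH.
Qed.

(* The blanks written when the head passes over them stay in the lists of the
   tape. *)
Definition holds_word (t : tape) (w : word) : Prop :=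
  exists m n, t = (nseq m None, map some w ++ nseq n None).

Definition holds (ts : tapes) (s : regs) : Prop :=
  forall i, holds_word (ts i) (s i).

Definition computes (M : submachine) (ts : tapes) (s' : regs) (t : nat) : Prop :=
  exists q ts', [/\ steps t (sub_start M) ts q ts', sub_step q ts' = None &
                    holds ts' s'].

Lemma read_holds t w : holds_word t w -> read t = ohead w.
Proof. by case=> m [n ->]; case: w => [|b w] //; case: n. Qed.

(** Idling can change the representation: rewriting a scanned blank adds a cell to an empty list.
    The trailing blanks of [holds_word] absorb it. *)
Lemma idle_holds ts s :
  holds ts s -> holds (act_tapes (idle (scan_tapes ts)) ts) s.
Proof.
move=> ts_s i; rewrite !ffunE /=; case: (ts_s i) => m [n ->].
rewrite /read /=; case: (s i) => [|b w] /=; last by exists m, n.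
by case: n => [|n]; [exists m, 1 | exists m, n.+1].
Qed.

Lemma scan_holds ts s i :
  i <= k -> holds ts s -> scan_tapes ts (inord i) = ohead (s i).
Proof.
by move=> le_ik /(_ (inord i)) /read_holds; rewrite ffunE inordK.
Qed.

Lemma act_holds ts s i w a m :
  holds ts s -> (forall t, holds_word t (s i) ->
                   holds_word (write_move a m t) w) ->
  holds (act_tapes (act_on i a m (scan_tapes ts)) ts) (upd s i w).
Proof.
move=> ts_s act_i j; rewrite !ffunE /upd; case: eqP => [<-|_ /=] in act_i *.
  exact: act_i.
by have:= idle_holds ts_s j; rewrite !ffunE.
Qed.

Lemma pop_holds t w :
  holds_word t w -> holds_word (write_move None MoveRight t) (behead w).
Proof.
case=> m [n ->] /=; case: w => [|b w] /=; last by exists m.+1, n.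
by exists m.+1, n.-1; case: n.
Qed.

Lemma push_holds t w b : holds_word t w ->
  holds_word (write_move (Some b) Stay (write_move (read t) MoveLeft t))
             (b :: w).
Proof.
case=> m [n ->]; rewrite /read /=.
case: w => [|c w] /=.
  exists m.-1, n.-1.+1; by case: m; case: n.
by exists m.-1, n; case: m.
Qed.

Lemma computes_push b i ts s :
  i <= k -> holds ts s ->
  computes (push_machine b i) ts (upd s i (b :: s i)) 2.
Proof.
move=> le_ik ts_s; pose ts1 := act_tapes
  (act_on i (scan_tapes ts (inord i)) MoveLeft (scan_tapes ts)) ts.
exists (Some true), (act_tapes (act_on i (Some b) Stay (scan_tapes ts1)) ts1).
split=> //; first by apply: (@StepsS (push_machine b i) _ _ _ (Some false) ts1) => //;
    apply: StepsS => //; exact: Steps0.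
move=> j; rewrite /upd; have [def_j|ne_ji] := eqVneq (j : nat) i.
  have := push_holds b (ts_s j).
  rewrite !ffunE def_j eqxx /= (_ : inord i = j) ?ffunE //.
  by apply: val_inj; rewrite /= inordK.
have: holds_word (ts1 j) (s j).
  have := idle_holds ts_s j; by rewrite !ffunE (negPf ne_ji).
rewrite !ffunE (negPf ne_ji) /= => -[m [n ->]]; rewrite /read /=.
case: (s j) => [|c w] /=; last by exists m, n.
by exists m, n.-1.+1; case: n.
Qed.

Lemma computes_seq M N ts s s' t u :
  computes M ts s t -> (forall ts1, holds ts1 s -> computes N ts1 s' u) ->
  computes (seq_machine M N) ts s' (t + u).+1.
Proof.
case=> q1 [ts1 [steps1 stop1 ts1_s]].
case/(_ _ (idle_holds ts1_s))=> q2 [ts2 [steps2 stop2 ts2_s']].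
exists (inr q2), ts2; split=> //; last first.
  by move: stop2; rewrite !sub_stepE /=; case: (sub_delta _ _) => [[]|].
rewrite -addnS; apply: steps_trans (_ : steps (M := seq_machine M N) _ _ _ (inl q1) ts1) _.
  apply: steps_sim steps1 => q ts0 q' ts0'; rewrite !sub_stepE /=.
  by case: (sub_delta _ _) => [[q'' a] [<- <-]|].
apply: (@StepsS (seq_machine M N) _ _ _ (inr (sub_start N))).
  by move: stop1; rewrite !sub_stepE /=; case: (sub_delta _ _) => [[]|].
apply: steps_sim steps2 => q ts0 q' ts0'; rewrite !sub_stepE /=.
by case: (sub_delta _ _) => [[q'' a] [<- <-]|].
Qed.

Lemma computes_after M N (h : sub_state M -> sub_state N) ts s s' t :
  (forall q v, sub_delta (h q) v = map_state h (sub_delta q v)) ->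
  sub_delta (sub_start N) (scan_tapes ts) =
    Some (h (sub_start M), idle (scan_tapes ts)) ->
  holds ts s -> (forall ts1, holds ts1 s -> computes M ts1 s' t) ->
  computes N ts s' t.+1.
Proof.
move=> sim start ts_s /(_ _ (idle_holds ts_s))[q [ts' [steps1 stop ts'_s']]].
exists (h q), ts'; split=> //; last first.
  by move: stop; rewrite !sub_stepE sim; case: (sub_delta _ _) => [[]|].
apply: (StepsS (q2 := h (sub_start M))); first by rewrite sub_stepE start.
apply: steps_sim steps1 => q1 ts1 q2 ts2; rewrite !sub_stepE sim.
by case: (sub_delta _ _) => [[q'' a] [<- <-]|].
Qed.

Lemma computes_while i M ts s1 s2 s3 t u :
  i <= k -> s1 i != [::] -> holds ts s1 ->
  (forall ts1, holds ts1 s1 -> computes M ts1 s2 t) ->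
  (forall ts1, holds ts1 s2 -> computes (while_machine i M) ts1 s3 u) ->
  computes (while_machine i M) ts s3 (t + u).+2.
Proof.
move=> le_ik s1i ts_s1 /(_ _ (idle_holds ts_s1))[q [ts1 [steps1 stop1 ts1_s2]]].
case/(_ _ (idle_holds ts1_s2))=> q' [ts2 [steps2 stop2 ts2_s3]].
exists q', ts2; split=> //.
apply: (@StepsS (while_machine i M) _ _ _ (Some (sub_start M))).
  rewrite sub_stepE /= (scan_holds le_ik ts_s1).
  by case: (s1 i) s1i.
rewrite -addnS; apply: steps_trans (_ : steps (M := while_machine i M) _ _ _ (Some q) ts1) _.
  apply: steps_sim steps1 => q1 ts0 q2 ts0'; rewrite !sub_stepE /=.
  by case: (sub_delta _ _) => [[q'' a] [<- <-]|].
apply: StepsS steps2.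
by move: stop1; rewrite !sub_stepE /=; case: (sub_delta _ _) => [[]|].
Qed.

Lemma compile_correct p s s' t ts :
  exec p s s' t -> max_reg p <= k -> holds ts s -> computes (compile p) ts s' t.
Proof.
(* Induction on the execution rather than on the program: the remaining iterations of a loop are an
   execution of the same loop. *)
move=> run_p; elim: run_p ts => {p s s' t} /=.
- by move=> s ts _ ts_s; exists tt, ts; split=> //; exact: Steps0.
- by move=> b i s ts le_ik ts_s; exact: computes_push.
- move=> i s ts le_ik ts_s.
  exists true, (act_tapes (act_on i None MoveRight (scan_tapes ts)) ts).
  split=> //; first by apply: StepsS => //; exact: Steps0.
  by apply: act_holds => // t; exact: pop_holds.
- move=> p q s1 s2 s3 t u _ IHp _ IHq ts; rewrite geq_max => /andP[ok_p ok_q].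
  by move=> ts_s; apply: computes_seq (IHp _ ok_p ts_s) _ => ts1; exact: IHq.
- move=> i p q r s s' t s_i _ IH ts; rewrite !geq_max => /and4P[le_ik ok_p _ _].
  move=> ts_s; apply: (@computes_after (compile p) (case_machine i (compile p) (compile q) (compile r))
    (Some \o inl) _ s) => //.
    by rewrite /= (scan_holds le_ik ts_s) s_i.
  by move=> ts1; exact: IH.
- move=> i p q r s s' t w s_i _ IH ts; rewrite !geq_max => /and4P[le_ik _ ok_q _].
  move=> ts_s; apply: (@computes_after (compile q) (case_machine i (compile p) (compile q) (compile r))
    (Some \o (inr \o inl)) _ s) => //.
    by rewrite /= (scan_holds le_ik ts_s) s_i.
  by move=> ts1; exact: IH.
- move=> i p q r s s' t w s_i _ IH ts; rewrite !geq_max => /and4P[le_ik _ _ ok_r].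
  move=> ts_s; apply: (@computes_after (compile r) (case_machine i (compile p) (compile q) (compile r))
    (Some \o (inr \o inr)) _ s) => //.
    by rewrite /= (scan_holds le_ik ts_s) s_i.
  by move=> ts1; exact: IH.
- move=> i p s s_i ts; rewrite geq_max => /andP[le_ik _] ts_s.
  exists None, ts; split=> //; first exact: Steps0.
  by rewrite sub_stepE /= (scan_holds le_ik ts_s) s_i.
- move=> i p s1 s2 s3 t u s1_i _ IHp _ IHw ts ok_w ts_s.
  have /andP[le_ik ok_p]: (i <= k) && (max_reg p <= k) by rewrite -geq_max.
  apply: computes_while s1_i ts_s _ _ => // ts1; first exact: IHp.
  exact: IHw.
Qed.

Lemma runS M n q ts : run (M := machine_of M) n.+1 (q, ts) =
  if sub_step q ts is Some c then run (M := machine_of M) n c else (q, ts).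
Proof. by []. Qed.

(** Extra fuel is harmless because [run] stays at a halted configuration; an upper bound on the time
    is therefore enough. *)
Lemma run_steps M n q ts q' ts' m :
  steps (M := M) n q ts q' ts' -> sub_step q' ts' = None -> n <= m ->
  run (M := machine_of M) m (q, ts) = (q', ts').
Proof.
move=> steps1 stop; elim: steps1 stop m => {n q ts q' ts'}.
  by move=> q ts stop [|m] // _; rewrite runS stop.
move=> n q1 ts1 q2 ts2 q3 ts3 step1 _ IH stop [//|m] le_nm.
by rewrite runS step1; exact: IH.
Qed.

End Compile.

Lemma exec_outputs_within (k : nat) (p : prog) (xs : seq word) s' t m :
  exec p (nth [::] xs) s' t -> max_reg p <= k -> t <= m ->
  outputs_within (machine_of (compile k p)) xs (s' 0) m.
Proof.
move=> run_p ok_p le_tm.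
pose ts := [ffun i : 'I_k.+1 => ([::] : seq symbol, map some (nth [::] xs i))].
have ts_s : holds ts (nth [::] xs).
  by move=> i; rewrite ffunE; exists 0, 0; rewrite cats0.
have [q [ts' [steps1 stop ts'_s']]] := compile_correct run_p ok_p ts_s.
rewrite /outputs_within /init -/ts (run_steps steps1 stop le_tm); split=> //.
rewrite /output /=; have [m' [n ->]] := ts'_s' ord0 => /=.
by elim: (s' 0) => [|b w IH] /=; [case: n | rewrite IH].
Qed.

(** * Stack programs with a time bound *)

(** Total correctness from a single initial state. As [Q] is a predicate on the final state, the
    rest of a sequence can be nested in it. *)
Definition does (p : prog) (s : regs) (T : nat) (Q : regs -> Prop) : Prop :=
  exists s' t, [/\ exec p s s' t, t <= T & Q s'].

Lemma does_weaken p s T T' (Q Q' : regs -> Prop) :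
  does p s T Q -> T <= T' -> (forall s', Q s' -> Q' s') -> does p s T' Q'.
Proof.
case=> s' [t [run_p le_tT Qs']] le_TT' QQ'.
by exists s', t; split; [ | exact: leq_trans le_TT' | exact: QQ'].
Qed.

Lemma does_skip s (Q : regs -> Prop) : Q s -> does Skip s 0 Q.
Proof. by exists s, 0; split=> //; constructor. Qed.

Lemma does_push b i s (Q : regs -> Prop) :
  Q (upd s i (b :: s i)) -> does (Push b i) s 2 Q.
Proof. by exists (upd s i (b :: s i)), 2; split=> //; constructor. Qed.

Lemma does_pop i s (Q : regs -> Prop) :
  Q (upd s i (behead (s i))) -> does (Pop i) s 1 Q.
Proof. by exists (upd s i (behead (s i))), 1; split=> //; constructor. Qed.

Lemma does_seq p q s T U (Q : regs -> Prop) :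
  does p s T (fun s' => does q s' U Q) -> does (Seq p q) s (T + U).+1 Q.
Proof.
case=> s1 [t [run_p le_tT [s2 [u [run_q le_uU Qs2]]]]].
by exists s2, (t + u).+1; split=> //; [exact: ExecSeq run_p run_q | lia].
Qed.

Lemma does_case i p q r s T (Q : regs -> Prop) :
  does (if s i is b :: _ then if b then q else r else p) s T Q ->
  does (Case i p q r) s T.+1 Q.
Proof.
case=> s' [t [run_pqr le_tT Qs']]; exists s', t.+1; split=> //.
case def_si: (s i) run_pqr => [|[|] w] run_pqr.
- exact: ExecCaseNil.
- exact: ExecCaseTrue def_si _.
- exact: ExecCaseFalse def_si _.
Qed.

Lemma does_while i p (inv : nat -> regs -> Prop) T n s :
  (forall m s, inv m.+1 s -> s i != [::] /\ does p s T (inv m)) ->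
  (forall s, inv 0 s -> s i = [::]) ->
  inv n s -> does (While i p) s (n * T.+2) (inv 0).
Proof.
move=> invS inv0; elim: n s => [|n IHn] s.
  by move=> inv_s; exists s, 0; split=> //; constructor; exact: inv0.
case/invS=> s_i [s1 [t [run_p le_tT /IHn[s2 [u [run_w le_u inv2]]]]]].
exists s2, (t + u).+2; split=> //; first exact: ExecWhileStep run_p run_w.
by rewrite mulSn; lia.
Qed.

(** A popped bit has no place to live except in the control, so the continuation is generated once
    for each of its values. *)
Definition shift_bit (i : nat) (p : bool -> prog) : prog :=
  Case i Skip (Seq (Pop i) (p true)) (Seq (Pop i) (p false)).

Lemma does_shift_bit i p s b w T (Q : regs -> Prop) :
  s i = b :: w -> does (p b) (upd s i w) T Q -> does (shift_bit i p) s T.+3 Q.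
Proof.
move=> s_i do_p; apply: does_case; rewrite s_i.
have do_seq: does (Seq (Pop i) (p b)) s T.+2 Q.
  by apply: (does_seq (T := 1)); apply: does_pop; rewrite s_i.
by case: b do_seq {do_p s_i}.
Qed.

Definition clear (i : nat) : prog := While i (Pop i).

Lemma does_clear i s :
  does (clear i) s (3 * size (s i)) (fun s' => s' =1 upd s i [::]).
Proof.
rewrite mulnC.
apply: does_weaken (_ : does _ _ _ (fun s' => size (s' i) = 0 /\ forall j, j != i -> s' j = s j)) _ _.
- apply: (does_while (inv := fun m s' => size (s' i) = m /\ forall j, j != i -> s' j = s j)).
  + move=> m s' [sz_i eq_s']; split; first by case: (s' i) sz_i.
    apply: does_pop; split; first by rewrite /upd eqxx size_behead sz_i.
    by move=> j ne_ji; rewrite /upd (negPf ne_ji) eq_s'.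
  + by move=> s' [/size0nil].
  by [].
- by [].
move=> s' [/size0nil s'_i eq_s'] j; rewrite /upd; case: eqVneq => [->|] //.
exact: eq_s'.
Qed.

(** Reading a stack destroys and reverses it. Going through [tmp] reverses twice, which restores [i]
    and fills [j] at the same time. *)
Definition copy (i j tmp : nat) : prog :=
  Seq (While i (shift_bit i (fun b => Push b tmp)))
      (While tmp (shift_bit tmp (fun b => Seq (Push b i) (Push b j)))).

Lemma does_copy i j tmp s :
  i != j -> i != tmp -> j != tmp -> s j = [::] -> s tmp = [::] ->
  does (copy i j tmp) s (20 * size (s i) + 1) (fun s' => s' =1 upd s j (s i)).
Proof.
move=> ne_ij ne_it ne_jt s_j s_t; set w := s i.
(* In both loops [tmp] holds, reversed, the letters missing from [i]. An iteration costs 7 steps in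
   the first loop and 10 in the second; the bound rounds 17 up to 20. *)
pose inv1 m (s1 : regs) := [/\ size (s1 i) = m, catrev (s1 tmp) (s1 i) = w &
  forall k, k != i -> k != tmp -> s1 k = s k].
pose inv2 m (s1 : regs) := [/\ size (s1 tmp) = m, catrev (s1 tmp) (s1 i) = w,
  s1 i = s1 j & forall k, k != i -> k != tmp -> k != j -> s1 k = s k].
have do1: does (While i (shift_bit i (fun b => Push b tmp))) s (size w * 7) (inv1 0).
  apply: does_while; last by split=> //; rewrite s_t.
    move=> m s1 []; case def_i: (s1 i) => [//|b v] [sz_v] def_w eq_s1; split=> //.
    apply: (does_shift_bit def_i) => //; apply: does_push; rewrite /upd; split=> /=.
    - by rewrite eqxx (negPf ne_it).
    - by rewrite !eqxx (negPf ne_it) [tmp == i]eq_sym (negPf ne_it).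
    - by move=> k ne_ki ne_kt; rewrite (negPf ne_ki) (negPf ne_kt) eq_s1.
  by move=> s1 [/size0nil].
have do2 s1: inv1 0 s1 ->
    does (While tmp (shift_bit tmp (fun b => Seq (Push b i) (Push b j)))) s1
      (size w * 10) (inv2 0).
  case=> /size0nil s1_i def_w eq_s1.
  have <-: size (s1 tmp) = size w by rewrite -def_w s1_i size_rev.
  apply: does_while; last first.
    split=> // [|k ki kt kj]; last exact: eq_s1.
    by rewrite s1_i eq_s1 // 1?eq_sym.
    by move=> s2 [/size0nil].
  move=> m s2 []; case def_t: (s2 tmp) => [//|b v] [sz_v] /= def_w2 eq_ij eq_s2; split=> //.
  apply: (does_shift_bit def_t) => //; apply: (does_seq (T := 2) (U := 2)); apply: does_push; apply: does_push.
  rewrite /upd; split=> /=.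
  - by rewrite eqxx (eq_sym tmp j) (eq_sym tmp i) (negPf ne_it) (negPf ne_jt).
  - by rewrite !eqxx (eq_sym tmp j) (eq_sym tmp i) (negPf ne_it) (negPf ne_jt) (negPf ne_ij).
  - by rewrite !eqxx (negPf ne_ij) (negPf ne_it) (eq_sym j i) (negPf ne_ij) (negPf ne_jt) eq_ij.
  - by move=> k ki kt kj; rewrite (negPf kj) (negPf ki) (negPf kt) eq_s2.
apply: does_weaken (_ : does _ _ (size w * 7 + size w * 10).+1 (inv2 0)) _ _.
- apply: does_seq; apply: does_weaken do1 _ do2; exact: leqnn.
- lia.
move=> s' [/size0nil s'_t def_w eq_ij eq_s'] k; rewrite s'_t /= in def_w; rewrite /upd.
have [->|ne_kj] := eqVneq k j; first by rewrite -eq_ij.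
have [->|ne_ki] := eqVneq k i; first by rewrite def_w.
have [->|ne_kt] := eqVneq k tmp; first by rewrite s'_t s_t.
exact: eq_s'.
Qed.

(** * Clearing and copying lists of registers *)

Definition total_size (ws : seq word) : nat := sumn (map size ws).

Lemma total_size_cat ws ws' :
  total_size (ws ++ ws') = total_size ws + total_size ws'.
Proof. by rewrite /total_size map_cat sumn_cat. Qed.

Definition clears (ks : seq nat) : prog := foldr (fun i => Seq (clear i)) Skip ks.

Lemma does_clears ks s :
  does (clears ks) s (3 * total_size (map s ks) + size ks)
    (fun s' => forall i, s' i = if i \in ks then [::] else s i).
Proof.
elim: ks s => [|i ks IH] s; first exact: does_skip.
apply: does_weaken (_ : does _ _ ((3 * size (s i)) +
  (3 * total_size (map s ks) + size ks)).+1 _) _ _; last first.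
- by move=> s'; exact.
- rewrite /total_size /=; lia.
apply: does_seq; apply: does_weaken (does_clear i s) (leqnn _) _ => s1 eq_s1.
apply: does_weaken (IH s1) _ _.
  rewrite leq_add2r leq_mul2l /=; rewrite /total_size.
  elim: (ks) => //= j js IHj; apply: leq_add => //.
  by rewrite eq_s1 /upd; case: ifP.
move=> s2 eq_s2 j; rewrite eq_s2 inE eq_s1 /upd.
by case: eqVneq => [->|_] //=; case: ifP.
Qed.

Fixpoint copies (ks js : seq nat) (tmp : nat) : prog :=
  match ks, js with
  | k :: ks', j :: js' => Seq (copy k j tmp) (copies ks' js' tmp)
  | _, _ => Skip
  end.

Lemma does_copies ks js tmp s :
  size ks = size js -> uniq js -> {in js, forall j, j \notin ks} ->
  tmp \notin ks -> tmp \notin js ->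
  {in js, forall j, s j = [::]} -> s tmp = [::] ->
  does (copies ks js tmp) s (20 * total_size (map s ks) + 2 * size ks)
    (fun s' => map s' js = map s ks /\ forall i, i \notin js -> s' i = s i).
Proof.
elim: ks js s => [|i ks IH] [|j js] s //=; first by move=> *; exact: does_skip.
case=> sz_is /andP[js_j uniq_js] disj; rewrite !inE !negb_or.
move=> /andP[ne_ti t_is] /andP[ne_tj t_js] s_js s_t.
apply: does_weaken (_ : does _ _ ((20 * size (s i) + 1) +
  (20 * total_size (map s ks) + 2 * size ks)).+1 _) _ _; last first.
- by move=> s'; exact.
- rewrite /total_size /=; lia.
apply: does_seq.
have j_is: j \notin i :: ks by apply: disj; exact: mem_head.
rewrite inE negb_or in j_is; case/andP: j_is => ne_ji j_is.
apply: does_weaken (does_copy _ _ _ _ _) (leqnn _) _; rewrite 1?eq_sym //.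
  by apply: s_js; exact: mem_head.
move=> s1 eq_s1.
have eq_is: map s1 ks = map s ks.
  by apply/eq_in_map => k k_is; rewrite eq_s1 /upd; case: eqVneq => // eq_kj; rewrite -eq_kj k_is in j_is.
apply: does_weaken (IH js s1 _ _ _ _ _ _ _) _ _ => //.
- move=> k k_js; have: k \notin i :: ks by apply: disj; rewrite inE k_js orbT.
  by rewrite inE negb_or => /andP[].
- move=> k k_js; rewrite eq_s1 /upd; case: eqVneq => [eq_kj|_].
    by rewrite -eq_kj k_js in js_j.
  by apply: s_js; rewrite inE k_js orbT.
- by rewrite eq_s1 /upd (negPf ne_tj).
- by rewrite eq_is.
move=> s2 [eq_js eq_s2]; split.
  by rewrite eq_js eq_is eq_s2 // eq_s1 /upd eqxx.
move=> k; rewrite inE negb_or => /andP[ne_kj k_js].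
by rewrite eq_s2 // eq_s1 /upd (negPf ne_kj).
Qed.

(** * Types stored in registers *)

(** The width depends on the type only, so the code of a function is fixed before its argument is
    known. *)
Class reg (T : Type) := Reg {
  width : nat;
  enc : T -> seq word;
  size_enc : forall x, size (enc x) = width
}.
Arguments width T {_}.

#[export] Instance reg_word : reg word :=
  @Reg word 1 (fun w => [:: w]) (fun _ => erefl).
#[export] Instance reg_bool : reg bool :=
  @Reg bool 1 (fun b => [:: [:: b]]) (fun _ => erefl).
#[export] Instance reg_nat : reg nat :=
  @Reg nat 1 (fun n => [:: nseq n true]) (fun _ => erefl).

Lemma size_enc_pair (A B : Type) (rA : reg A) (rB : reg B) (x : A * B) :
  size (enc x.1 ++ enc x.2) = width A + width B.
Proof. by rewrite size_cat !size_enc. Qed.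

#[export] Instance reg_pair (A B : Type) (rA : reg A) (rB : reg B) :
  reg (A * B) := @Reg (A * B) _ (fun x => enc x.1 ++ enc x.2) (size_enc_pair rA rB).

Definition rsize {A : Type} {rA : reg A} (x : A) : nat := total_size (enc x).

Lemma rsize_word (w : word) : rsize w = size w.
Proof. by rewrite /rsize /total_size /= addn0. Qed.

Lemma rsize_bool (b : bool) : rsize b = 1.
Proof. by []. Qed.

Lemma rsize_nat (n : nat) : rsize n = n.
Proof. by rewrite /rsize /total_size /= addn0 size_nseq. Qed.

Lemma rsize_pair (A B : Type) (rA : reg A) (rB : reg B) (x : A * B) :
  rsize x = rsize x.1 + rsize x.2.
Proof. exact: total_size_cat. Qed.

Definition rsizeE := (rsize_pair, rsize_word, rsize_bool, rsize_nat).

Section PolyBounded.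

Context {A : Type} {rA : reg A}.
Implicit Types phi psi : A -> nat.

(** A monomial in the successor of the size bounds every polynomial, is monotone in the size, and
    its powers grow with the exponent; this makes sums, products and compositions immediate. *)
Definition poly_bounded phi : Prop :=
  exists c k, forall a, phi a <= c * (rsize a).+1 ^ k.

Lemma poly_bounded_le phi psi :
  (forall a, phi a <= psi a) -> poly_bounded psi -> poly_bounded phi.
Proof.
by move=> le [c [k b]]; exists c, k => a; exact: leq_trans (le a) (b a).
Qed.

Lemma poly_bounded_const n : poly_bounded (fun=> n).
Proof. by exists n, 0 => a; rewrite muln1. Qed.

Lemma poly_bounded_rsize : poly_bounded rsize.
Proof. by exists 1, 1 => a; rewrite mul1n expn1. Qed.

Lemma poly_bounded_add phi psi :
  poly_bounded phi -> poly_bounded psi -> poly_bounded (fun a => phi a + psi a).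
Proof.
case=> c [k b] [c' [k' b']]; exists (c + c'), (k + k') => a.
rewrite mulnDl; apply: leq_add.
  apply: leq_trans (b a) _; rewrite leq_mul2l; apply/orP; right.
  by apply: leq_pexp2l => //; exact: leq_addr.
apply: leq_trans (b' a) _; rewrite leq_mul2l; apply/orP; right.
by apply: leq_pexp2l => //; exact: leq_addl.
Qed.

Lemma poly_bounded_mul phi psi :
  poly_bounded phi -> poly_bounded psi -> poly_bounded (fun a => phi a * psi a).
Proof.
case=> c [k b] [c' [k' b']]; exists (c * c'), (k + k') => a.
by rewrite expnD mulnACA leq_mul.
Qed.

Lemma poly_bounded_exp phi k :
  poly_bounded phi -> poly_bounded (fun a => phi a ^ k).
Proof.
move=> b; elim: k => [|k IH]; first exact: poly_bounded_const.
apply: poly_bounded_le (poly_bounded_mul b IH) => a; by rewrite expnS.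
Qed.

Lemma poly_bounded_S phi :
  poly_bounded phi -> poly_bounded (fun a => (phi a).+1).
Proof.
move=> b; apply: poly_bounded_le (poly_bounded_add (poly_bounded_const 1) b).
by [].
Qed.

End PolyBounded.

Lemma poly_bounded_comp (A B : Type) (rA : reg A) (rB : reg B)
    (phi : B -> nat) (f : A -> B) (psi : A -> nat) :
  poly_bounded phi -> (forall a, rsize (f a) <= psi a) -> poly_bounded psi ->
  poly_bounded (fun a => phi (f a)).
Proof.
case=> c [k b] le_f b_f.
apply: poly_bounded_le (poly_bounded_mul (poly_bounded_const c)
  (poly_bounded_exp k (poly_bounded_S b_f))) => a.
apply: leq_trans (b _) _; rewrite leq_mul2l; apply/orP; right.
by case: k {b} => // k; rewrite leq_exp2r // ltnS.
Qed.

(** * Functions computed in polynomial time on registers *)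

(* A code generator receives the registers of the arguments, those of the
   results, and a number above which all the registers are free. *)
Definition generator := seq nat -> seq nat -> nat -> prog.

Record ready (args outs : seq nat) (base : nat) (s : regs) : Prop := Ready {
  ready_args : {in args, forall i, i < base};
  ready_outs : {in outs, forall i, i < base};
  ready_uniq : uniq outs;
  ready_disjoint : {in outs, forall i, i \notin args};
  ready_blank : {in outs, forall i, s i = [::]};
  ready_free : forall i, base <= i -> s i = [::]
}.

Definition implements {A B : Type} {rA : reg A} {rB : reg B}
    (gen : generator) (f : A -> B) (T : A -> nat) : Prop :=
  forall a args outs base s,
    map s args = enc a -> size outs = width B -> ready args outs base s ->
    does (gen args outs base) s (T a)
      (fun s' => map s' outs = enc (f a) /\ forall i, i \notin outs -> s' i = s i).

(** The size of the result is bounded along with the time, because a composition runs its second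
    function on that result. *)
Definition PT {A B : Type} {rA : reg A} {rB : reg B} (f : A -> B) : Prop :=
  exists gen T, [/\ implements gen f T, poly_bounded T &
                    poly_bounded (fun a => rsize (f a))].

Lemma ready_base args outs base s : ready args outs base s ->
  base \notin args /\ base \notin outs.
Proof.
case=> lt_args lt_outs _ _ _ _.
by split; apply/negP; [move/lt_args | move/lt_outs]; rewrite ltnn.
Qed.

Lemma total_size_map A (rA : reg A) (a : A) (s : regs) args :
  map s args = enc a -> total_size (map s args) = rsize a.
Proof. by move->. Qed.

Section Closure.

Context {A : Type} {rA : reg A}.

Lemma PT_eq (B : Type) (rB : reg B) (f g : A -> B) : f =1 g -> PT f -> PT g.
Proof.
move=> eq_fg [gen [T [impl bT bf]]]; exists gen, T; split=> //.
  by move=> a args outs base s; rewrite -eq_fg; exact: impl.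
by apply: poly_bounded_le bf => a; rewrite eq_fg.
Qed.

(** The intermediate value occupies the first free registers and [base] is raised above them. They
    are cleared at the end because [implements] promises that everything outside the results is
    unchanged. *)
Lemma PT_comp (B C : Type) (rB : reg B) (rC : reg C) (f : A -> B) (g : B -> C) :
  PT g -> PT f -> PT (fun a => g (f a)).
Proof.
case=> gg [Tg [impl_g bTg bg]] [gf [Tf [impl_f bTf bf]]].
exists (fun args outs base => let mids := iota base (width B) in
  Seq (gf args mids (base + width B))
    (Seq (gg mids outs (base + width B)) (clears mids))),
  (fun a => (Tf a + (Tg (f a) + (3 * rsize (f a) + width B)).+1).+1).
split; last by apply: poly_bounded_comp bg _ bf => a.
  move=> a args outs base s args_a sz_outs [lt_args lt_outs uniq_outs disj blank free] /=.
  apply: does_seq; set mids := iota _ _.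
  have in_mids i: (i \in mids) = (base <= i < base + width B) by rewrite mem_iota.
  have mids_outs i: i \in outs -> i \notin mids.
    by move=> /lt_outs lt_i; rewrite in_mids leqNgt lt_i.
  apply: does_weaken (impl_f a _ _ _ _ args_a (size_iota _ _) _) (leqnn _) _.
    split=> [i /lt_args|i||i|i|i]; rewrite ?in_mids ?iota_uniq //; try lia.
    - by case/andP=> le_i _; apply/negP => /lt_args; rewrite ltnNge le_i.
    - by case/andP=> /free.
    - by move=> le_i; apply: free; lia.
  move=> s1 [s1_mids eq_s1]; apply: does_seq.
  apply: does_weaken (impl_g (f a) _ _ _ _ s1_mids sz_outs _) (leqnn _) _.
    split=> [i|i /lt_outs|//|//|i i_outs|i le_i]; rewrite ?in_mids; try lia.
    - by rewrite eq_s1 ?blank // mids_outs.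
    - by rewrite eq_s1 ?free // ?in_mids; lia.
  move=> s2 [s2_outs eq_s2].
  have s2_mids: map s2 mids = enc (f a).
    rewrite -s1_mids; apply/eq_in_map => i i_mids; apply: eq_s2.
    by apply/negP => /mids_outs; rewrite i_mids.
  apply: does_weaken (does_clears mids s2) _ _.
    by rewrite (total_size_map s2_mids) size_iota.
  move=> s3 eq_s3; split.
    rewrite -s2_outs; apply/eq_in_map => i i_outs; rewrite eq_s3.
    by rewrite (negPf (mids_outs i i_outs)).
  move=> i i_outs; rewrite eq_s3; case: ifPn => [|i_mids]; last by rewrite eq_s2 // eq_s1.
  by rewrite in_mids => /andP[/free->].
apply: poly_bounded_S; apply: poly_bounded_add => //.
apply: poly_bounded_S; apply: poly_bounded_add; first by apply: poly_bounded_comp bTg _ bf => a.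
apply: poly_bounded_add (poly_bounded_const _).
exact: poly_bounded_mul (poly_bounded_const _) bf.
Qed.

Lemma PT_pair (B C : Type) (rB : reg B) (rC : reg C) (f : A -> B) (g : A -> C) :
  PT f -> PT g -> PT (fun a => (f a, g a)).
Proof.
case=> gf [Tf [impl_f bTf bf]] [gg [Tg [impl_g bTg bg]]].
exists (fun args outs base => Seq (gf args (take (width B) outs) base)
                                  (gg args (drop (width B) outs) base)),
  (fun a => (Tf a + Tg a).+1).
split.
- move=> a args outs base s args_a sz_outs [lt_args lt_outs uniq_outs disj blank free].
  apply: does_seq.
  have def_outs := cat_take_drop (width B) outs.
  have sz1: size (take (width B) outs) = width B by rewrite size_takel // sz_outs leq_addr.
  have sz2: size (drop (width B) outs) = width C by rewrite size_drop sz_outs addKn.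
  set o1 := take _ _ in def_outs sz1 *; set o2 := drop _ _ in def_outs sz2 *.
  have in_outs i: (i \in outs) = (i \in o1) || (i \in o2) by rewrite -def_outs mem_cat.
  move: uniq_outs; rewrite -def_outs cat_uniq => /and3P[uniq1 disj12 uniq2].
  have o12 i: i \in o2 -> i \notin o1.
    by move=> i_o2; apply/negP => i_o1; case/hasP: disj12; exists i.
  apply: does_weaken (impl_f a _ _ base _ args_a sz1 _) (leqnn _) _.
    split=> // i i_o1; have i_o: i \in outs by rewrite in_outs i_o1.
    + exact: lt_outs.
    + exact: disj.
    + exact: blank.
  move=> s1 [s1_o1 eq_s1].
  have s1_args: map s1 args = enc a.
    rewrite -args_a; apply/eq_in_map => i i_args; apply: eq_s1; apply/negP => i_o1.
    by have := disj i; rewrite in_outs i_o1 i_args => /(_ isT).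
  apply: does_weaken (impl_g a _ _ base _ s1_args sz2 _) (leqnn _) _.
    split=> // i i_o2; first by apply: lt_outs; rewrite in_outs i_o2 orbT.
    - by apply: disj; rewrite in_outs i_o2 orbT.
    - by rewrite eq_s1 ?o12 // blank // in_outs i_o2 orbT.
    - rewrite eq_s1 ?free //; apply/negP=> i_o1; have := lt_outs i.
      by rewrite in_outs i_o1 ltnNge i_o2 => /(_ isT).
  move=> s2 [s2_o2 eq_s2]; split.
    rewrite map_cat s2_o2 /= -s1_o1; congr (_ ++ _); apply/eq_in_map => i i_o1.
    by apply: eq_s2; apply/negP => /o12; rewrite i_o1.
  by move=> i; rewrite mem_cat negb_or => /andP[i_o1 i_o2]; rewrite eq_s2 // eq_s1.
- exact: poly_bounded_S (poly_bounded_add bTf bTg).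
- apply: poly_bounded_le (poly_bounded_add bf bg) => a; by rewrite rsize_pair.
Qed.

(** Identity and projections are one program: [sel] chooses registers from their list alone,
    whatever they contain. *)
Lemma PT_copy (B : Type) (rB : reg B) (f : A -> B)
    (sel : seq nat -> seq nat) :
  (forall args, {subset sel args <= args}) ->
  (forall a args (s : regs), map s args = enc a -> map s (sel args) = enc (f a)) ->
  (forall a, rsize (f a) <= rsize a) -> PT f.
Proof.
move=> sub_sel map_sel le_f.
exists (fun args outs base => copies (sel args) outs base),
  (fun a => 20 * rsize a + 2 * width B); split.
- move=> a args outs base s args_a sz_outs rdy.
  have [base_args base_outs] := ready_base rdy.
  case: rdy => lt_args lt_outs uniq_outs disj blank free.
  have sel_a := map_sel _ _ _ args_a.
  have sz_sel: size (sel args) = width B by rewrite -(size_map s) sel_a size_enc.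
  apply: does_weaken (does_copies (s := s) _ uniq_outs _ _ base_outs blank _) _ _.
  + by rewrite sz_sel.
  + by move=> i /disj; apply: contra => /sub_sel.
  + by apply: contra base_args => /sub_sel.
  + exact: free.
  + by rewrite (total_size_map sel_a) sz_sel leq_add2r leq_mul2l le_f orbT.
  by move=> s1; rewrite sel_a.
- apply: poly_bounded_add (poly_bounded_const _).
  exact: poly_bounded_mul (poly_bounded_const _) poly_bounded_rsize.
- exact: poly_bounded_le le_f poly_bounded_rsize.
Qed.

Lemma PT_id : PT (fun a : A => a).
Proof. by apply: (PT_copy (sel := id)) => [args i|a args s|a]. Qed.

Lemma PT_if (B : Type) (rB : reg B) (c : A -> bool) (f g : A -> B) :
  PT c -> PT f -> PT g -> PT (fun a => if c a then f a else g a).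
Proof.
case=> gc [Tc [impl_c bTc bc]] [gf [Tf [impl_f bTf bf]]] [gg [Tg [impl_g bTg bg]]].
exists (fun args outs base => Seq (gc args [:: base] base.+1)
   (shift_bit base (fun b => if b then gf args outs base.+1 else gg args outs base.+1))),
  (fun a => (Tc a + (Tf a + Tg a).+3).+1).
split.
- move=> a args outs base s args_a sz_outs rdy.
  have [base_args base_outs] := ready_base rdy.
  case: rdy => lt_args lt_outs uniq_outs disj blank free.
  apply: does_seq; apply: does_weaken (impl_c a _ [:: base] _ _ args_a _ _) (leqnn _) _ => //.
    split=> //.
    + by move=> i /lt_args lt_i; exact: leqW.
    + by move=> i; rewrite inE => /eqP->.
    + by move=> i; rewrite inE => /eqP->.
    + by move=> i; rewrite inE => /eqP->; exact: free.
    + by move=> i lt_i; apply: free; exact: ltnW.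
  move=> s1 [[s1_b] eq_s1]; apply: does_shift_bit s1_b _.
  (* Popping the condition makes register [base] blank again, so the branches start from the
     original state. *)
  have eq_s2 i : upd s1 base [::] i = s i.
    rewrite /upd; case: eqVneq => [->|ne_i]; first by rewrite free.
    by rewrite eq_s1 // inE.
  have args2: map (upd s1 base [::]) args = enc a by rewrite (eq_map eq_s2).
  have rdy2: ready args outs base.+1 (upd s1 base [::]).
    split=> //.
    + by move=> i /lt_args lt_i; exact: leqW.
    + by move=> i /lt_outs lt_i; exact: leqW.
    + by move=> i i_outs; rewrite eq_s2 blank.
    + by move=> i lt_i; rewrite eq_s2 free // ltnW.
  case: (c a).
    apply: does_weaken (impl_f a _ _ _ _ args2 sz_outs rdy2) (leq_addr _ _) _.
    by move=> s3 [s3_outs eq_s3]; split=> // i i_outs; rewrite eq_s3.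
  apply: does_weaken (impl_g a _ _ _ _ args2 sz_outs rdy2) (leq_addl _ _) _.
  by move=> s3 [s3_outs eq_s3]; split=> // i i_outs; rewrite eq_s3.
- apply: poly_bounded_S; apply: poly_bounded_add => //.
  by do 3!apply: poly_bounded_S; apply: poly_bounded_add.
- apply: poly_bounded_le (poly_bounded_add bf bg) => a.
  by case: (c a); [exact: leq_addr | exact: leq_addl].
Qed.

Definition push_word (w : word) (o : nat) : prog :=
  foldr (fun b p => Seq p (Push b o)) Skip w.

Lemma does_push_word w o s : s o = [::] ->
  does (push_word w o) s (3 * size w) (fun s' => s' =1 upd s o w).
Proof.
move=> s_o; elim: w => [|b w IH] /=.
  by apply: does_skip => i; rewrite /upd; case: eqP => [->|].
apply: does_weaken (_ : does _ _ (3 * size w + 2).+1 _) _ _; last by move=> s'; exact.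
  apply: does_seq; apply: does_weaken IH (leqnn _) _ => s1 eq_s1.
  apply: does_push => i; rewrite /upd; case: eqP => [_|ne_i].
    by rewrite eq_s1 /upd eqxx.
  by rewrite eq_s1 /upd; case: eqP.
lia.
Qed.

Lemma PT_const_word (w : word) : PT (fun _ : A => w).
Proof.
exists (fun _ outs _ => push_word w (head 0 outs)), (fun _ => 3 * size w).
split; [ | exact: poly_bounded_const..].
move=> a args [|o [|]] base s _ //= _ [_ _ _ _ blank _].
apply: does_weaken (does_push_word w (blank o (mem_head _ _))) (leqnn _) _.
move=> s1 eq_s1; rewrite eq_s1 /upd eqxx; split=> // i.
by rewrite inE eq_s1 /upd => /negPf->.
Qed.

(** Programs see only register contents, so a change of type that preserves the encoding costs
    nothing. *)
Lemma PT_enc (B C : Type) (rB : reg B) (rC : reg C) (f : A -> B) (g : A -> C) :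
  width B = width C -> (forall a, enc (f a) = enc (g a)) -> PT f -> PT g.
Proof.
move=> eq_w eq_enc [gen [T [impl bT bf]]]; exists gen, T; split=> //.
  move=> a args outs base s; rewrite -eq_w -eq_enc; exact: impl.
by apply: poly_bounded_le bf => a; rewrite /rsize eq_enc.
Qed.

Lemma PT_const_nat (n : nat) : PT (fun _ : A => n).
Proof. exact: PT_enc (PT_const_word (nseq n true)). Qed.

Lemma PT_const_bool (b : bool) : PT (fun _ : A => b).
Proof. exact: PT_enc (PT_const_word [:: b]). Qed.

End Closure.

(** * Projections and primitive operations on words *)

Lemma PT_fst {A B : Type} {rA : reg A} {rB : reg B} : PT (fun x : A * B => x.1).
Proof.
apply: (PT_copy (sel := take (width A))).
- by move=> args i; exact: mem_take.
- by move=> [a b] args s; rewrite map_take => -> /=; rewrite take_size_cat ?size_enc.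
- by move=> x; rewrite rsize_pair leq_addr.
Qed.

Lemma PT_snd {A B : Type} {rA : reg A} {rB : reg B} : PT (fun x : A * B => x.2).
Proof.
apply: (PT_copy (sel := drop (width A))).
- by move=> args i; exact: mem_drop.
- by move=> [a b] args s; rewrite map_drop => -> /=; rewrite drop_size_cat ?size_enc.
- by move=> x; rewrite rsize_pair leq_addl.
Qed.

Lemma PT_cons_pair : PT (fun x : bool * word => x.1 :: x.2).
Proof.
exists (fun args outs base => Seq (copy (nth 0 args 1) (head 0 outs) base)
  (Case (head 0 args) Skip (Push true (head 0 outs)) (Push false (head 0 outs)))),
  (fun x => (20 * size x.2 + 1 + 3).+1).
split.
- move=> [b w] [|i [|j []]] [|o []] base s //= [s_i s_j] _ rdy.
  have [] := ready_base rdy; rewrite !inE !negb_or => /andP[ne_bi ne_bj] ne_bo.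
  case: rdy => _ _ _ /(_ o (mem_head _ _)) ne_o /(_ o (mem_head _ _)) s_o free.
  rewrite !inE negb_or in ne_o; case/andP: ne_o => ne_oi ne_oj.
  apply: does_seq.
  apply: does_weaken (does_copy _ _ _ s_o (free _ (leqnn _))) _ _; rewrite 1?eq_sym //.
    by rewrite s_j.
  move=> s1 eq_s1; apply: does_case.
  rewrite eq_s1 {1}/upd eq_sym (negPf ne_oi) s_i.
  suff push: does (Push b o) s1 2 (fun s' => [:: s' o] = [:: b :: w] /\
      forall i0, i0 \notin [:: o] -> s' i0 = s i0) by case: b push {s_i}.
  apply: does_push; rewrite /upd eqxx eq_s1 /upd eqxx s_j; split=> // k.
  by rewrite inE => /negPf ne_ko; rewrite ne_ko eq_s1 /upd ne_ko.
- apply: poly_bounded_S; do 2!apply: poly_bounded_add (poly_bounded_const _).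
  apply: poly_bounded_mul; first exact: poly_bounded_const.
  apply: poly_bounded_le poly_bounded_rsize => -[b w]; rewrite !rsizeE /=; lia.
- apply: poly_bounded_le (poly_bounded_rsize) => -[b w].
  by rewrite !rsizeE /=; lia.
Qed.

Lemma PT_behead_word : PT (fun w : word => behead w).
Proof.
exists (fun args outs base => Seq (copy (head 0 args) (head 0 outs) base)
                                  (Pop (head 0 outs))),
  (fun w => (20 * size w + 1 + 1).+1).
split.
- move=> w [|i []] [|o []] base s //= [s_i] _ rdy.
  have [] := ready_base rdy; rewrite !inE => ne_bi ne_bo.
  case: rdy => _ _ _ /(_ o (mem_head _ _)) ne_o /(_ o (mem_head _ _)) s_o free.
  rewrite inE in ne_o.
  apply: does_seq.
  apply: does_weaken (does_copy _ _ _ s_o (free _ (leqnn _))) _ _; rewrite 1?eq_sym //.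
    by rewrite s_i.
  move=> s1 eq_s1; apply: does_pop.
  rewrite /upd eqxx eq_s1 /upd eqxx s_i; split=> // k.
  by rewrite inE => /negPf ne_ko; rewrite ne_ko eq_s1 /upd ne_ko.
- apply: poly_bounded_S; do 2!apply: poly_bounded_add (poly_bounded_const _).
  apply: poly_bounded_mul; first exact: poly_bounded_const.
  by apply: poly_bounded_le poly_bounded_rsize => w; rewrite !rsizeE.
- apply: poly_bounded_le poly_bounded_rsize => w.
  by rewrite !rsizeE size_behead leq_pred.
Qed.

(** This single [Case] yields both the emptiness test and the first letter, whose default is
    [false]. *)
Lemma PT_test (c1 c2 c3 : bool) :
  PT (fun w : word => if w is b :: _ then if b then c2 else c3 else c1).
Proof.
exists (fun args outs _ => let o := head 0 outs in
  Case (head 0 args) (Push c1 o) (Push c2 o) (Push c3 o)), (fun _ => 3).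
split; [ | exact: poly_bounded_const..].
move=> w [|i []] [|o []] base s //= [s_i] _ [_ _ _ _ blank _].
have s_o := blank o (mem_head _ _).
have push c : does (Push c o) s 2 (fun s' => [:: s' o] = [:: [:: c]] /\
    forall i0, i0 \notin [:: o] -> s' i0 = s i0).
  apply: does_push; rewrite /upd eqxx s_o; split=> // k.
  by rewrite inE => /negPf->.
apply: does_case; rewrite s_i; case: w {s_i} => [|[] w]; exact: push.
Qed.

(** Layout: [base] holds the unread letters and controls the loop, [base.+1] the current letter,
    [cur] the state and [new] the next state, which is computed apart because results must be blank
    and disjoint from arguments. The argument registers are only read. *)
Lemma PT_foldl_state (X A S : Type) (rX : reg X) (rA : reg A) (rS : reg S)
    (arg : X -> A) (init : X -> S) (bits : X -> word)
    (step : A * S * bool -> S) (Q : X -> nat) :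
  (forall x, enc x = (enc (arg x) ++ enc (init x)) ++ [:: bits x]) ->
  PT step -> poly_bounded Q ->
  (forall x w1 w2, bits x = w1 ++ w2 ->
     rsize (foldl (fun s b => step (arg x, s, b)) (init x) w1) <= Q x) ->
  PT (fun x => foldl (fun s b => step (arg x, s, b)) (init x) (bits x)).
Proof.
move=> enc_x; case=> gen [T [impl [c [k bT]] _]] bQ leQ.
pose wA := @width A rA; pose wS := @width S rS.
(* One iteration: 20 and 3 per letter to copy back and erase the new state, 3 to erase the old one,
   and the time of [step] on argument, state and bit. The last two terms cover the overhead. *)
pose bodyT x := Q x * 23 + Q x * 3 + c * (@rsize _ rX x + Q x + 1).+1 ^ k + 10 * wS + 20.
exists (fun args outs base =>
  let cur := iota base.+2 wS in let new := iota (base.+2 + wS) wS in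
  let base' := base.+2 + wS + wS in
  let body := Seq (gen (take wA args ++ cur ++ [:: base.+1]) new base')
    (Seq (clears (base.+1 :: cur))
      (Seq (copies new cur base') (clears new))) in
  Seq (copies (drop wA args) (rcons cur base) base')
    (Seq (While base (shift_bit base (fun b => Seq (Push b base.+1) body)))
       (Seq (copies cur outs base') (clears cur)))),
  (fun x => ((20 * rsize x + 2 * wS.+1) +
     ((rsize x * (bodyT x).+2) + ((20 * Q x + 2 * wS) + (3 * Q x + wS)).+1).+1).+1).
split; last first.
- by apply: poly_bounded_le bQ => x; apply: leQ (esym (cats0 _)).
- have bR := @poly_bounded_rsize _ rX.
  repeat first [apply: poly_bounded_add | apply: poly_bounded_S | exact: poly_bounded_const
    | exact: bR | exact: bQ | apply: poly_bounded_mul | apply: poly_bounded_exp].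
move=> x args outs base s args_x sz_outs rdy.
case: rdy => lt_args lt_outs uniq_outs disj blank free /=.
set cur := iota _ _; set new := iota _ _; set base' := _ + wS.
have in_cur i: (i \in cur) = (base.+2 <= i < base.+2 + wS) by rewrite mem_iota.
have in_new i: (i \in new) = (base.+2 + wS <= i < base') by rewrite mem_iota.
have uniq_cur: uniq (rcons cur base) by rewrite rcons_uniq iota_uniq in_cur; lia.
pose fold w := foldl (fun s b => step (arg x, s, b)) (init x) w.
have args_A: map s (take wA args) = enc (arg x).
  by rewrite map_take args_x enc_x -catA take_size_cat ?size_enc.
have args_SW: map s (drop wA args) = rcons (enc (init x)) (bits x).
  by rewrite map_drop args_x enc_x -catA drop_size_cat ?size_enc // cats1.
have sz_SW: size (drop wA args) = wS.+1.
  by rewrite -(size_map s) args_SW size_rcons size_enc.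
have lt_A i: i \in take wA args -> i < base by move/mem_take/lt_args.
have lt_SW i: i \in drop wA args -> i < base by move/mem_drop/lt_args.
have rs_x: rsize x = rsize (arg x) + rsize (init x) + size (bits x).
  by rewrite /rsize enc_x !total_size_cat /total_size /= addn0.
apply: does_seq.
apply: does_weaken (does_copies (s := s) _ uniq_cur _ _ _ _ _) _ _.
- by rewrite sz_SW size_rcons size_iota.
- by move=> i; rewrite mem_rcons inE in_cur => i_in; apply/negP => /lt_SW; lia.
- by apply/negP => /lt_SW; rewrite /base'; lia.
- by rewrite mem_rcons inE in_cur /base'; lia.
- by move=> i; rewrite mem_rcons inE in_cur => i_in; apply: free; lia.
- by apply: free; rewrite /base'; lia.
- rewrite sz_SW leq_add2r leq_mul2l args_SW -cats1 total_size_cat rs_x.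
  by rewrite /total_size /= addn0 -addnA leq_addl.
move=> s1 [s1_cur eq_s1].
have [s1_c s1_b]: map s1 cur = enc (init x) /\ s1 base = (bits x).
  by move: s1_cur; rewrite map_rcons args_SW => /rcons_inj[].
(* [w1] has been consumed and [w2], of length [m], is still in [base]. All other registers agree
   with the initial state, so the scratch registers are blank before each iteration. *)
pose inv m (s' : regs) := exists w1, exists2 w2, (bits x) = w1 ++ w2 &
  [/\ size w2 = m, s' base = w2, map s' cur = @enc S rS (fold w1) &
      forall i, i != base -> i \notin cur -> s' i = s i].
apply: does_seq.
apply: does_weaken (does_while (inv := inv) (T := bodyT x) (n := size (bits x)) _ _ _) _ _; first last.
- move=> s2 [w1 [w2 def_x2 [/size0nil w2_nil s2_b s2_cur eq_s2]]].
  rewrite w2_nil cats0 in def_x2 s2_b; rewrite -def_x2 in s2_cur.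
  apply: does_seq.
  apply: does_weaken (does_copies (s := s2) _ uniq_outs _ _ _ _ _) _ _.
  + by rewrite size_iota.
  + by move=> i /lt_outs lt_i; rewrite in_cur; lia.
  + by rewrite in_cur /base'; lia.
  + by apply/negP => /lt_outs; rewrite /base'; lia.
  + move=> i i_outs; have := lt_outs i i_outs => lt_i.
    by rewrite eq_s2 ?blank // ?in_cur; lia.
  + by rewrite eq_s2 ?free // ?in_cur /base'; lia.
  + rewrite (total_size_map s2_cur) size_iota leq_add2r leq_mul2l.
    by rewrite (leQ _ _ [::]) ?cats0.
  move=> s3 [s3_outs eq_s3].
  have s3_cur: map s3 cur = map s2 cur.
    apply/eq_in_map => i; rewrite in_cur => i_in; apply: eq_s3.
    by apply/negP => /lt_outs; lia.
  apply: does_weaken (does_clears _ _) _ _.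
    rewrite s3_cur (total_size_map s2_cur) size_iota leq_add2r leq_mul2l.
    by rewrite (leQ _ _ [::]) ?cats0.
  move=> s4 eq_s4; split.
    rewrite -s2_cur -s3_outs; apply/eq_in_map => i /lt_outs lt_i.
    by rewrite eq_s4 in_cur; case: ifP => //; lia.
  move=> i i_outs; rewrite eq_s4; case: ifPn => i_cur.
    by rewrite free //; move: i_cur; rewrite in_cur; lia.
  rewrite eq_s3 //; have [->|ne_ib] := eqVneq i base; last exact: eq_s2.
  by rewrite s2_b free.
- by rewrite leq_mul2r rs_x leq_addl orbT.
- exists [::], (bits x) => //; split=> // i ne_ib i_cur; apply: eq_s1.
  by rewrite mem_rcons inE negb_or ne_ib.
- by move=> s2 [w1 [w2 _ [/size0nil-> ->]]].
move=> m s2 [w1 [w2' def_x2 []]].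
case: w2' def_x2 => [|b w2] // def_x2 [sz_w2] s2_b s2_cur eq_s2.
split; first by rewrite s2_b.
have bodyTE: bodyT x >= (2 + (c * (rsize x + Q x + 1).+1 ^ k +
    ((3 * (Q x + 1) + wS.+1) +
      ((20 * Q x + 2 * wS) + (3 * Q x + wS)).+1).+1).+1).+4.
  rewrite /bodyT; lia.
apply: (fun H => does_weaken H bodyTE (fun _ => id)).
apply: does_shift_bit s2_b _; apply: does_seq; apply: does_push.
have s2_S: s2 base.+1 = [::] by rewrite eq_s2 ?free // ?in_cur; lia.
have neS: base.+1 == base = false by lia.
set s3 := upd _ _ _.
have s3_b: s3 base = w2 by rewrite /s3 /upd eq_sym neS eqxx.
have s3_S: s3 base.+1 = [:: b] by rewrite /s3 /upd eqxx neS s2_S.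
have s3_cur: map s3 cur = map s2 cur.
  apply/eq_in_map => i; rewrite in_cur /s3 /upd => i_in.
  by do 2!(case: eqP => [?|_]; first lia).
have eq_s3 i: i != base -> i != base.+1 -> i \notin cur -> s3 i = s i.
  move=> ne_ib ne_iS i_cur.
  by rewrite /s3 /upd (negPf ne_ib) (negPf ne_iS) eq_s2.
apply: does_seq.
have s3_args: map s3 (take wA args ++ cur ++ [:: base.+1]) = enc (arg x, fold w1, b).
  rewrite !map_cat /= s3_S s3_cur s2_cur -args_A -catA; congr (_ ++ _ ++ _).
  apply/eq_in_map => i /lt_A lt_i; apply: eq_s3; rewrite ?in_cur; lia.
have le_w1: rsize (fold w1) <= Q x by exact: leQ def_x2.
have le_w1b: rsize (fold (rcons w1 b)) <= Q x by apply: (leQ _ _ w2); rewrite cat_rcons.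
apply: does_weaken (impl _ _ new base' _ s3_args _ _) _ _.
- by rewrite size_iota.
- split=> [i|i|||i|i].
  + rewrite !mem_cat inE in_cur; case/or3P=> [/lt_A||]; rewrite /base'; lia.
  + rewrite in_new; lia.
  + exact: iota_uniq.
  + move=> i; rewrite in_new !mem_cat inE in_cur => i_new; apply/negP.
    by case/or3P=> [/lt_A||]; lia.
  + by rewrite in_new => i_new; rewrite eq_s3 ?free // ?in_cur; lia.
  + by rewrite /base' => i_le; rewrite eq_s3 ?free // ?in_cur; lia.
- apply: leq_trans (bT _) _; rewrite leq_mul2l; apply/orP; right.
  have: rsize (arg x, fold w1, b) <= rsize x + Q x + 1 by rewrite !rsizeE /= -/(rsize _); lia.
  by case: (k) => // k' le_r; rewrite leq_exp2r // ltnS.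
move=> s4 [s4_new eq_s4].
have def_new: step (arg x, fold w1, b) = fold (rcons w1 b) by rewrite /fold foldl_rcons.
rewrite {}def_new in s4_new.
have s4_cur: map s4 cur = enc (fold w1).
  rewrite -s2_cur -s3_cur; apply/eq_in_map => i; rewrite in_cur => i_in; apply: eq_s4.
  rewrite in_new; lia.
have s4_S: s4 base.+1 = [:: b] by rewrite eq_s4 // in_new; lia.
apply: does_seq; apply: does_weaken (does_clears (base.+1 :: cur) s4) _ _.
  rewrite /= s4_S s4_cur size_iota /total_size /= -/(total_size _) -/(rsize _); lia.
move=> s5 eq_s5; apply: does_seq.
have s5_new: map s5 new = enc (fold (rcons w1 b)).
  rewrite -s4_new; apply/eq_in_map => i; rewrite in_new => i_in; rewrite eq_s5.
  by rewrite inE in_cur; case: ifP => //; lia.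
have s5_i i: i < base.+2 + wS -> i != base -> i \notin cur -> s5 i = s i.
  move=> lt_i ne_ib i_cur; rewrite eq_s5 inE (negPf i_cur) orbF.
  case: eqP => [->|/eqP ne_iS]; first by rewrite free.
  by rewrite eq_s4 ?eq_s3 // in_new; lia.
have s5_free i: base' <= i -> s5 i = [::].
  rewrite /base' => le_i; rewrite eq_s5 inE in_cur; case: ifP => // _.
  by rewrite eq_s4 ?eq_s3 ?free // ?in_new ?in_cur; lia.
apply: does_weaken (does_copies (s := s5) _ _ _ _ _ _ _) _ _.
- by rewrite !size_iota.
- exact: iota_uniq.
- by move=> i; rewrite in_cur in_new; lia.
- by rewrite in_new; lia.
- by rewrite in_cur /base'; lia.
- by move=> i i_cur; rewrite eq_s5 inE i_cur orbT.
- exact: s5_free.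
- by rewrite (total_size_map s5_new) size_iota leq_add2r leq_mul2l le_w1b orbT.
move=> s6 [s6_cur eq_s6].
have s6_new: map s6 new = map s5 new.
  by apply/eq_in_map => i; rewrite in_new => i_in; apply: eq_s6; rewrite in_cur; lia.
apply: does_weaken (does_clears _ _) _ _.
  by rewrite s6_new (total_size_map s5_new) size_iota leq_add2r leq_mul2l le_w1b orbT.
move=> s7 eq_s7; exists (rcons w1 b), w2; first by rewrite cat_rcons.
split=> //.
- rewrite eq_s7 in_new; case: ifP => [|_]; first lia.
  rewrite eq_s6 ?in_cur; last lia.
  rewrite eq_s5 inE in_cur; case: ifP => [|_]; first lia.
  by rewrite eq_s4 ?s3_b // in_new; lia.
- rewrite -s5_new -s6_cur; apply/eq_in_map => i; rewrite in_cur => i_in.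
  by rewrite eq_s7 in_new; case: ifP => //; lia.
- move=> i ne_ib i_cur; rewrite eq_s7; case: ifPn => i_new.
    by rewrite free //; move: i_new; rewrite in_new; lia.
  rewrite eq_s6 //; have [lt_i|le_i] := ltnP i (base.+2 + wS); first exact: s5_i.
  have le_i': base' <= i by move: i_new; rewrite in_new le_i /= -leqNgt.
  by rewrite s5_free // free //; rewrite /base' in le_i'; lia.
Qed.

(** * Boolean connectives, and folds with computed data *)

Section DerivedClosure.

Context {A : Type} {rA : reg A}.

Lemma PT_bound (B : Type) (rB : reg B) (f : A -> B) :
  PT f -> poly_bounded (fun a => rsize (f a)).
Proof. by case=> gen [T []]. Qed.

Lemma PT_fstE (B C : Type) (rB : reg B) (rC : reg C) (f : A -> B * C) :
  PT f -> PT (fun a => (f a).1).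
Proof. exact: PT_comp PT_fst. Qed.

Lemma PT_sndE (B C : Type) (rB : reg B) (rC : reg C) (f : A -> B * C) :
  PT f -> PT (fun a => (f a).2).
Proof. exact: PT_comp PT_snd. Qed.

Lemma PT_cons (b : A -> bool) (w : A -> word) :
  PT b -> PT w -> PT (fun a => b a :: w a).
Proof. move=> ptb ptw; exact: PT_comp PT_cons_pair (PT_pair ptb ptw). Qed.

Lemma PT_behead (w : A -> word) : PT w -> PT (fun a => behead (w a)).
Proof. exact: PT_comp PT_behead_word. Qed.

Lemma PT_nilp (w : A -> word) : PT w -> PT (fun a => nilp (w a)).
Proof.
move=> ptw; apply: PT_eq (PT_comp (PT_test true false false) ptw) => a.
by case: (w a) => [|[]].
Qed.

Lemma PT_head (w : A -> word) : PT w -> PT (fun a => head false (w a)).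
Proof.
move=> ptw; apply: PT_eq (PT_comp (PT_test false true false) ptw) => a.
by case: (w a) => [|[]].
Qed.

Lemma PT_negb (b : A -> bool) : PT b -> PT (fun a => ~~ b a).
Proof.
move=> ptb; apply: PT_eq (PT_if ptb (PT_const_bool false) (PT_const_bool true)).
by move=> a; case: (b a).
Qed.

Lemma PT_andb (b c : A -> bool) : PT b -> PT c -> PT (fun a => b a && c a).
Proof.
move=> ptb ptc; apply: PT_eq (PT_if ptb ptc (PT_const_bool false)).
by move=> a; case: (b a).
Qed.

Lemma PT_orb (b c : A -> bool) : PT b -> PT c -> PT (fun a => b a || c a).
Proof.
move=> ptb ptc; apply: PT_eq (PT_if ptb (PT_const_bool true) ptc).
by move=> a; case: (b a).
Qed.

Lemma PT_implb (b c : A -> bool) : PT b -> PT c -> PT (fun a => b a ==> c a).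
Proof.
move=> ptb ptc; apply: PT_eq (PT_if ptb ptc (PT_const_bool true)).
by move=> a; case: (b a).
Qed.

Lemma PT_eqb (b c : A -> bool) : PT b -> PT c -> PT (fun a => b a == c a).
Proof.
move=> ptb ptc; apply: PT_eq (PT_if ptb ptc (PT_negb ptc)).
by move=> a; case: (b a); case: (c a).
Qed.

Lemma PT_nseq (n : A -> nat) : PT n -> PT (fun a => nseq (n a) true).
Proof. by apply: PT_enc. Qed.

Lemma PT_succ (n : A -> nat) : PT n -> PT (fun a => (n a).+1).
Proof.
move=> ptn; apply: PT_enc (PT_cons (PT_const_bool true) (PT_nseq ptn)) => //.
Qed.

(* A bound on the intermediate states has to be supplied: the size of an
   iterated polynomial-time step may grow exponentially. *)
Lemma PT_foldl (S : Type) (rS : reg S) (step : A -> S -> bool -> S)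
    (init : A -> S) (bits : A -> word) (Q : A -> nat) :
  PT (fun x : A * S * bool => step x.1.1 x.1.2 x.2) -> PT init -> PT bits ->
  poly_bounded Q ->
  (forall a w1 w2, bits a = w1 ++ w2 ->
     rsize (foldl (step a) (init a) w1) <= Q a) ->
  PT (fun a => foldl (step a) (init a) (bits a)).
Proof.
move=> pt_step pt_init pt_bits bQ leQ.
have size_enc' a : size ((enc a ++ enc (init a)) ++ [:: bits a]) = width A + width S + 1.
  by rewrite !size_cat !size_enc.
(* [A] is encoded anew, with [init a] and [bits a] stored beside [a]. A product type would demand
   the size bound for arbitrary initial states and words, whereas [leQ] gives it only for those that
   come from some [a]. *)
pose r := Reg size_enc'.
have pt_id: @PT A A rA r id.
  exact: (@PT_enc _ _ _ _ _ _ _ (fun a => a)) (PT_pair (PT_pair PT_id pt_init) pt_bits).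
have pt_fold := @PT_foldl_state A A S r rA rS id init bits _ Q (fun=> erefl) pt_step.
apply: (@PT_comp A rA A S r rS id (fun a => foldl (step a) (init a) (bits a)) _ pt_id).
apply: pt_fold => //.
case: bQ => c [k bQ]; exists c, k => a; apply: leq_trans (bQ a) _.
rewrite leq_mul2l; apply/orP; right; case: (k) => // k'.
rewrite leq_exp2r // ltnS [X in _ <= X]/rsize /=.
by rewrite !total_size_cat -addnA leq_addr.
Qed.

End DerivedClosure.

Ltac pt_user := fail.

(* [PT_fst] and [PT_snd] must be tried on syntactic projections only, whence
   the match. *)
Ltac pt_step :=
  lazymatch goal with
  | |- PT (fun a => a) => exact PT_id
  | |- PT (fun a => (@?f a, @?g a)) => apply (PT_pair (f := f) (g := g))
  | |- PT (fun a => fst (@?f a)) => apply (PT_fstE (f := f))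
  | |- PT (fun a => snd (@?f a)) => apply (PT_sndE (f := f))
  | |- PT (fun a => @?b a :: @?w a) =>
    first [exact (PT_const_word _) | apply (PT_cons (b := b) (w := w))]
  | |- PT (fun a => behead (@?w a)) => apply (PT_behead (w := w))
  | |- PT (fun a => nilp (@?w a)) => apply (PT_nilp (w := w))
  | |- PT (fun a => head false (@?w a)) => apply (PT_head (w := w))
  | |- PT (fun a => ~~ (@?b a)) => apply (PT_negb (b := b))
  | |- PT (fun a => @?b a && @?c a) => apply (PT_andb (b := b) (c := c))
  | |- PT (fun a => @?b a || @?c a) => apply (PT_orb (b := b) (c := c))
  | |- PT (fun a => @?b a ==> @?c a) => apply (PT_implb (b := b) (c := c))
  | |- PT (fun a => S (@?n a)) =>
    first [exact (PT_const_nat _) | apply (PT_succ (n := n))]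
  | |- PT (fun a => nseq (@?n a) true) => apply (PT_nseq (n := n))
  | |- PT fst => exact PT_fst
  | |- PT snd => exact PT_snd
  | |- _ => first [assumption | exact (PT_const_word _) | exact (PT_const_bool _)
                 | exact (PT_const_nat _) | apply PT_eqb | apply PT_if | pt_user]
  end.

Ltac pt := repeat pt_step.

(** Records are stored as tuples of their fields and enumerations as numbers, so that constructors
    and projections reduce to those of [U]. *)
Definition reg_via (T U : Type) (rU : reg U) (f : T -> U) : reg T :=
  @Reg T _ (fun t => enc (f t)) (fun t => size_enc (f t)).

Lemma PT_via (T U : Type) (rU : reg U) (f : T -> U) :
  @PT T U (reg_via rU f) rU f.
Proof. exact: (@PT_enc T (reg_via rU f) T U (reg_via rU f) rU id f) (PT_id). Qed.

Lemma PT_to_via (A T U : Type) (rA : reg A) (rU : reg U) (f : T -> U) (g : A -> T) :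
  PT (fun a => f (g a)) -> @PT A T rA (reg_via rU f) g.
Proof. exact: PT_enc. Qed.

(** * Polynomial time on words *)

Section Words.

Context {A : Type} {rA : reg A}.

Lemma PT_rev (w : A -> word) : PT w -> PT (fun a => rev (w a)).
Proof.
move=> ptw; pose step (_ : A) s (b : bool) := b :: s.
apply: (@PT_eq _ _ _ _ (fun a => foldl (step a) [::] (w a))).
  move=> a; rewrite /rev; elim: (w a) [::] => //= b v IH s; exact: IH.
apply: (PT_foldl (Q := fun a => rsize (w a))) => //.
- exact: PT_cons PT_snd (PT_comp PT_snd PT_fst).
- exact: PT_const_word.
- exact: PT_bound.
move=> a w1 w2 ->; rewrite !rsizeE size_cat.
suff ->: size (foldl (step a) [::] w1) = size w1 by exact: leq_addr.
by elim/last_ind: w1 => //= v b IH; rewrite foldl_rcons size_rcons -IH.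
Qed.

Lemma PT_cat (v w : A -> word) : PT v -> PT w -> PT (fun a => v a ++ w a).
Proof.
move=> ptv ptw; pose step (_ : A) s (b : bool) := b :: s.
have foldE a s u: foldl (step a) s u = catrev u s.
  by elim: u s => //= b u IH s; exact: IH.
apply: (@PT_eq _ _ _ _ (fun a => foldl (step a) (w a) (rev (v a)))).
  by move=> a; rewrite foldE catrevE revK.
apply: (PT_foldl (Q := fun a => rsize (v a) + rsize (w a))) => //.
- exact: PT_cons PT_snd (PT_comp PT_snd PT_fst).
- exact: PT_rev.
- by apply: poly_bounded_add; exact: PT_bound.
move=> a w1 w2; rewrite foldE !rsizeE catrevE => def_v.
by rewrite -(size_rev (v a)) def_v !size_cat size_rev; lia.
Qed.

Lemma PT_rcons (w : A -> word) (b : A -> bool) :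
  PT w -> PT b -> PT (fun a => rcons (w a) (b a)).
Proof.
move=> ptw ptb.
apply: PT_eq (PT_cat ptw (PT_cons ptb (PT_const_word [::]))) => a.
by rewrite cats1.
Qed.

(** Lengths are passed as words: one [behead] for each letter of [v]. *)
Lemma PT_drop_size (v w : A -> word) :
  PT v -> PT w -> PT (fun a => drop (size (v a)) (w a)).
Proof.
move=> ptv ptw; pose step (_ : A) (s : word) (b : bool) := behead s.
have foldE a s u: foldl (step a) s u = drop (size u) s.
  by elim: u s => [|b u IH] s /=; [rewrite drop0 | rewrite IH; case: s].
apply: (@PT_eq _ _ _ _ (fun a => foldl (step a) (w a) (v a))) => [a|].
  exact: foldE.
apply: (PT_foldl (Q := fun a => rsize (w a))) => //.
- exact: PT_behead (PT_comp PT_snd PT_fst).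
- exact: PT_bound.
by move=> a w1 w2 _; rewrite foldE !rsizeE size_drop leq_subr.
Qed.

Lemma PT_take_size (v w : A -> word) :
  PT v -> PT w -> PT (fun a => take (size (v a)) (w a)).
Proof.
move=> ptv ptw.
(* A prefix is obtained from the reversed word by dropping as many letters as follow that prefix. *)
have drop2 a : drop (size (drop (size (v a)) (w a))) (rev (w a)) = rev (take (size (v a)) (w a)).
  by rewrite size_drop drop_rev; congr rev; have [le|lt] := leqP (size (w a)) (size (v a));
    [rewrite (eqP le) subn0 take_size take_oversize | rewrite subKn // ltnW].
apply: (@PT_eq _ _ _ _ (fun a => rev (drop (size (drop (size (v a)) (w a))) (rev (w a))))).
  by move=> a; rewrite drop2 revK.
by apply: PT_rev; apply: PT_drop_size; [exact: PT_drop_size | exact: PT_rev].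
Qed.

Lemma PT_prefix (v w : A -> word) : PT v -> PT w -> PT (fun a => prefix (v a) (w a)).
Proof.
move=> ptv ptw.
pose step (_ : A) (s : bool * word) (b : bool) :=
  (s.1 && (~~ nilp s.2 && (head false s.2 == b)), behead s.2).
have foldE a c s u: foldl (step a) (c, s) u = (c && prefix u s, drop (size u) s).
  elim: u c s => [|b u IH] c s /=; first by rewrite drop0 prefix0s andbT.
  rewrite {2}/step IH /=; case: s => [|d s] /=; first by rewrite !andbF.
  by rewrite -andbA eq_sym.
apply: (@PT_eq _ _ _ _ (fun a => (foldl (step a) (true, w a) (v a)).1)) => [a|].
  by rewrite foldE.
apply: PT_fstE; apply: (PT_foldl (Q := fun a => (rsize (w a)).+1)) => //.
- by rewrite /step; pt.
- exact: PT_pair (PT_const_bool true) ptw.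
- apply: poly_bounded_S; exact: PT_bound.
by move=> a w1 w2 _; rewrite foldE !rsizeE /= size_drop; lia.
Qed.

Lemma PT_eq_word (v w : A -> word) : PT v -> PT w -> PT (fun a => v a == w a).
Proof.
move=> ptv ptw.
apply: PT_eq (PT_andb (PT_prefix ptv ptw) (PT_prefix ptw ptv)) => a.
apply/andP/eqP => [[/prefixP[u ->] /size_prefix]|->]; last by rewrite prefix_refl.
by rewrite size_cat -[X in _ <= X]addn0 leq_add2l leqn0 size_eq0 => /eqP->; rewrite cats0.
Qed.

Lemma PT_size_eq (v w : A -> word) :
  PT v -> PT w -> PT (fun a => size (v a) == size (w a)).
Proof.
move=> ptv ptw.
have pt1 := PT_nilp (PT_drop_size ptv ptw); have pt2 := PT_nilp (PT_drop_size ptw ptv).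
apply: PT_eq (PT_andb pt1 pt2) => a.
by rewrite /nilp !size_drop !subn_eq0 andbC -eqn_leq.
Qed.

(** [s] does not depend on the argument, so the search is unrolled into the program. This is what
    allows the enumeration of candidate cliques, whose number depends on [r] only. *)
Lemma PT_has (I : Type) (s : seq I) (c : I -> A -> bool) :
  (forall i, PT (c i)) -> PT (fun a => has (c^~ a) s).
Proof.
move=> ptc; elim: s => [|i s IH] /=; first exact: PT_const_bool.
exact: PT_orb (ptc i) IH.
Qed.

Lemma PT_all (I : Type) (s : seq I) (c : I -> A -> bool) :
  (forall i, PT (c i)) -> PT (fun a => all (c^~ a) s).
Proof.
move=> ptc; elim: s => [|i s IH] /=; first exact: PT_const_bool.
exact: PT_andb (ptc i) IH.
Qed.

End Words.

(** * Soundness of [PT] *)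

Lemma horner_monomial (c k n : nat) :
  ((c%:P * ('X + 1) ^+ k)%R : {poly nat}).[n]%R = c * n.+1 ^ k.
Proof.
rewrite hornerM hornerC horner_exp hornerD hornerX hornerC.
by rewrite !natrE addn1.
Qed.

Lemma PT_outputs_within (A : Type) (rA : reg A) (f : A -> word) :
  0 < width A -> PT f ->
  exists (M : machine) (p : {poly nat}), forall a,
    outputs_within M (enc a) (f a) (p.[rsize a])%R.
Proof.
move=> n_gt0 [gen [T [impl bT bf]]]; set n := width A in n_gt0.
(* Results must avoid the argument registers, while the output is read on tape 0, which holds an
   input: the result goes to register [n] and is moved to tape 0 afterwards. *)
pose p := Seq (gen (iota 0 n) [:: n] n.+1) (Seq (clear 0) (copy n 0 n.+1)).
pose total a := (T a + (3 * @rsize _ rA a + (20 * @rsize _ reg_word (f a) + 1)).+1).+1.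
have [c [k b_total]]: poly_bounded total.
  do !first [exact: bT | exact: bf | exact: poly_bounded_rsize | exact: poly_bounded_const
    | apply: poly_bounded_S | apply: poly_bounded_add | apply: poly_bounded_mul].
exists (machine_of (compile (max_reg p) p)), (c%:P * ('X + 1) ^+ k)%R => a.
rewrite horner_monomial.
have enc_a: map (nth [::] (enc a)) (iota 0 n) = enc a.
  by rewrite -[RHS](mkseq_nth [::]) /mkseq size_enc.
have free i: n <= i -> nth [::] (enc a) i = [::] :> word.
  by move=> le_i; rewrite nth_default // size_enc.
suff [s' [t [run_p le_t <-]]]: does p (nth [::] (@enc A rA a)) (total a) (fun s' => s' 0 = f a).
  exact: exec_outputs_within run_p (leqnn _) (leq_trans le_t (b_total a)).
rewrite /p /total; apply: does_seq; apply: does_weaken (impl _ _ _ _ _ enc_a _ _) (leqnn _) _ => //.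
  split=> // i; rewrite ?mem_iota ?inE.
  - lia.
  - by move/eqP->.
  - by move/eqP->; lia.
  - by move/eqP->; exact: free.
  - by move=> lt_i; apply: free; exact: ltnW.
move=> s1 [[s1_n] eq_s1]; apply: does_seq.
have s1_0: size (s1 0) <= rsize a.
  rewrite eq_s1 ?inE 1?eq_sym -?lt0n // -(total_size_map enc_a).
  by rewrite -(prednK n_gt0) /total_size /= leq_addr.
apply: does_weaken (does_clear 0 s1) _ _; first by rewrite leq_mul2l s1_0 orbT.
move=> s2 eq_s2.
have := eq_s2 n; rewrite /upd (gtn_eqF n_gt0) s1_n => s2_n.
apply: does_weaken (does_copy _ _ _ _ _) _ _.
- by rewrite -lt0n.
- lia.
- by [].
- by rewrite eq_s2.
- by rewrite eq_s2 /upd /= eq_s1 ?free // inE; lia.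
- by rewrite s2_n rsize_word.
by move=> s3 ->; rewrite /upd /= s2_n.
Qed.

Lemma PT_polytime1 (f : word -> word) : PT f -> polytime1 f.
Proof.
case/PT_outputs_within=> // M [p out]; exists M, p => x.
by have := out x; rewrite rsize_word.
Qed.

Lemma PT_polytime2 (g : word -> word -> word) :
  PT (fun x : word * word => g x.1 x.2) -> polytime2 g.
Proof.
case/PT_outputs_within=> // M [p out]; exists M, p => x s.
by have := out (x, s); rewrite !rsizeE.
Qed.

(** * Parsing and evaluating circuits *)

(** States of an automaton that parses an encoded circuit and evaluates it on the way; [wires]
    accumulates the values computed so far. *)
Variant scan_ctrl :=
  | SizeBit | GateSep | Tag | NotOrConst | ConstBit | NotIndex | OpBit
  | FirstIndex | SecondIndex | OutSep | OutIndex | Finished | Failed.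

(* A wire number is read in unary by popping a copy of [wires]. *)
Record scan_state := ScanState {
  ctrl : scan_ctrl;
  wires : word;
  cursor : word;
  is_or : bool;
  operand : bool;
  outs : word
}.

Definition at_gate (vs : word) : scan_state :=
  ScanState GateSep vs [::] false false [::].

Definition at_output (vs out : word) : scan_state :=
  ScanState OutSep vs [::] false false out.

Definition finished (out : word) : scan_state :=
  ScanState Finished [::] [::] false false out.

Definition failed : scan_state := ScanState Failed [::] [::] false false [::].

(** The test [b == nilp cur] catches an announced number of inputs that is too large as well as one
    that is too small. An index out of range shows up as an empty cursor at its terminator, and a
    letter after the end leads to [Failed]. *)
Definition scan_step (st : scan_state) (b : bool) : scan_state :=
  let vs := wires st in let cur := cursor st in let c := head false cur in
  match ctrl st with
  | SizeBit =>
      if b == nilp cur then failed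
      else if b then ScanState SizeBit vs (behead cur) false false [::]
      else at_gate vs
  | GateSep => if b then ScanState Tag vs [::] false false [::]
               else at_output vs [::]
  | Tag => ScanState (if b then OpBit else NotOrConst) vs [::] false false [::]
  | NotOrConst => if b then ScanState NotIndex vs vs false false [::]
                  else ScanState ConstBit vs [::] false false [::]
  | ConstBit => at_gate (rcons vs b)
  | NotIndex =>
      if b then ScanState NotIndex vs (behead cur) false false [::]
      else if nilp cur then failed else at_gate (rcons vs (~~ c))
  | OpBit => ScanState FirstIndex vs vs b false [::]
  | FirstIndex =>
      if b then ScanState FirstIndex vs (behead cur) (is_or st) false [::]
      else if nilp cur then failed
      else ScanState SecondIndex vs vs (is_or st) c [::]
  | SecondIndex =>
      if b then ScanState SecondIndex vs (behead cur) (is_or st) (operand st) [::]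
      else if nilp cur then failed
      else at_gate (rcons vs
             (if is_or st then operand st || c else operand st && c))
  | OutSep => if b then ScanState OutIndex vs vs false false (outs st)
              else finished (outs st)
  | OutIndex =>
      if b then ScanState OutIndex vs (behead cur) false false (outs st)
      else if nilp cur then failed else at_output vs (rcons (outs st) c)
  | Finished | Failed => failed
  end.

Definition scan (x inst : word) : scan_state :=
  foldl scan_step (ScanState SizeBit x x false false [::]) inst.

Definition accepts (st : scan_state) : bool :=
  if ctrl st is Finished then true else false.

Lemma scan_failed w : foldl scan_step failed w = failed.
Proof. by elim: w. Qed.

Lemma scan_size vs cur m w :
  foldl scan_step (ScanState SizeBit vs cur false false [::]) (encode_nat m ++ w) =
  if m == size cur then foldl scan_step (at_gate vs) w else failed.
Proof.
elim: m cur => [|m IH] [|c cur] //=; rewrite ?scan_failed //.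
exact: IH.
Qed.

Lemma scan_not vs cur i w :
  foldl scan_step (ScanState NotIndex vs cur false false [::]) (encode_nat i ++ w) =
  if i < size cur then foldl scan_step (at_gate (rcons vs (~~ nth false cur i))) w
  else failed.
Proof.
elim: i cur => [|i IH] [|c cur] //=; rewrite ?scan_failed //; last exact: IH.
by rewrite IH.
Qed.

Lemma scan_first vs cur op i w :
  foldl scan_step (ScanState FirstIndex vs cur op false [::]) (encode_nat i ++ w) =
  if i < size cur
  then foldl scan_step (ScanState SecondIndex vs vs op (nth false cur i) [::]) w
  else failed.
Proof.
elim: i cur => [|i IH] [|c cur] //=; rewrite ?scan_failed //; last exact: IH.
by rewrite IH.
Qed.

Lemma scan_second vs cur op a i w :
  foldl scan_step (ScanState SecondIndex vs cur op a [::]) (encode_nat i ++ w) =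
  if i < size cur
  then foldl scan_step (at_gate (rcons vs
         (if op then a || nth false cur i else a && nth false cur i))) w
  else failed.
Proof.
elim: i cur => [|i IH] [|c cur] //=; rewrite ?scan_failed //; last exact: IH.
by rewrite IH.
Qed.

Lemma scan_out vs cur out i w :
  foldl scan_step (ScanState OutIndex vs cur false false out) (encode_nat i ++ w) =
  if i < size cur then foldl scan_step (at_output vs (rcons out (nth false cur i))) w
  else failed.
Proof.
elim: i cur => [|i IH] [|c cur] //=; rewrite ?scan_failed //; last exact: IH.
by rewrite IH.
Qed.

Lemma scan_gate vs g w :
  foldl scan_step (at_gate vs) (true :: encode_gate g ++ w) =
  if gate_ok (size vs) g then foldl scan_step (at_gate (rcons vs (gate_value vs g))) w
  else failed.
Proof.
case: g => [b|i|i j|i j] //=; first exact: scan_not.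
  by rewrite -catA scan_first; case: ifP => //= _; exact: scan_second.
by rewrite -catA scan_first; case: ifP => //= _; exact: scan_second.
Qed.

Lemma scan_gates vs gs w :
  foldl scan_step (at_gate vs) (encode_seq encode_gate gs ++ w) =
  if gates_ok (size vs) gs then
    foldl scan_step (at_output (foldl (fun vs g => rcons vs (gate_value vs g)) vs gs) [::]) w
  else failed.
Proof.
elim: gs vs => [|g gs IH] vs //.
rewrite [encode_seq _ _]/= -/(encode_seq _ gs) cat_cons -catA scan_gate /=.
by case: ifP => //= _; rewrite IH size_rcons.
Qed.

Lemma scan_outputs vs out os :
  foldl scan_step (at_output vs out) (encode_seq encode_nat os) =
  if all (fun j => j < size vs) os then
    finished (out ++ [seq nth false vs j | j <- os])
  else failed.
Proof.
elim: os out => [|o os IH] out /=; first by rewrite cats0.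
rewrite [scan_step _ _]/= scan_out; case: ifP => //= _.
by rewrite IH cat_rcons.
Qed.

Lemma size_run_gates vs gs :
  size (foldl (fun vs g => rcons vs (gate_value vs g)) vs gs) = size vs + size gs.
Proof.
by elim: gs vs => [|g gs IH] vs /=; rewrite ?addn0 // IH size_rcons addnS.
Qed.

Lemma scan_circuit x C :
  scan x (encode_circuit C) =
  if is_circuit (size x) (size (outputs C)) C then finished (eval C x) else failed.
Proof.
rewrite /scan /encode_circuit scan_size /is_circuit eqxx /=.
case: eqP => //= _; rewrite scan_gates; case: ifP => //= _.
by rewrite scan_outputs size_run_gates.
Qed.

(** Induction on the unread word: each control state determines the grammar of what an accepted run
    still has to read. Within the tag of a gate, the bits already consumed are put back in front. *)
Lemma scan_parses st w : accepts (foldl scan_step st w) ->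
  match ctrl st with
  | SizeBit => exists C, w = encode_circuit C
  | GateSep => exists gs os, w = encode_seq encode_gate gs ++ encode_seq encode_nat os
  | Tag => exists g gs os,
      w = encode_gate g ++ encode_seq encode_gate gs ++ encode_seq encode_nat os
  | NotOrConst => exists g gs os, false :: w =
      encode_gate g ++ encode_seq encode_gate gs ++ encode_seq encode_nat os
  | ConstBit => exists g gs os, [:: false, false & w] =
      encode_gate g ++ encode_seq encode_gate gs ++ encode_seq encode_nat os
  | NotIndex | SecondIndex => exists i gs os,
      w = encode_nat i ++ encode_seq encode_gate gs ++ encode_seq encode_nat os
  | OpBit => exists g gs os, true :: w =
      encode_gate g ++ encode_seq encode_gate gs ++ encode_seq encode_nat os
  | FirstIndex => exists i j gs os, w = encode_nat i ++ encode_nat j ++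
      encode_seq encode_gate gs ++ encode_seq encode_nat os
  | OutSep => exists os, w = encode_seq encode_nat os
  | OutIndex => exists i os, w = encode_nat i ++ encode_seq encode_nat os
  | Finished => w = [::]
  | Failed => False
  end.
Proof.
elim: w st => [|b w IH] [q vs cur op a out] /=; first by case: q.
move/IH=> {IH}; rewrite /scan_step /=; case: q => //=.
- case: b => /=; case: (nilp cur) => //=.
    by case=> -[m gs os] ->; exists (Circuit m.+1 gs os).
  by case=> gs [os ->]; exists (Circuit 0 gs os).
- case: b => /=.
    by case=> g [gs [os ->]]; exists (g :: gs), os; rewrite /= -catA.
  by case=> os ->; exists [::], os.
- by case: b => -[g [gs [os ->]]]; exists g, gs, os.
- case: b => /=; last by case=> g [gs [os ->]]; exists g, gs, os.
  by case=> i [gs [os ->]]; exists (Not i), gs, os.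
- by case=> gs [os ->]; exists (Const b), gs, os.
- case: b => /=; first by case=> i [gs [os ->]]; exists i.+1, gs, os.
  by case: (nilp cur) => //= -[gs [os ->]]; exists 0, gs, os.
- case=> i [j [gs [os ->]]].
  by case: b; [exists (Or i j), gs, os | exists (And i j), gs, os]; rewrite /= -!catA.
- case: b => /=; first by case=> i [j [gs [os ->]]]; exists i.+1, j, gs, os.
  by case: (nilp cur) => //= -[j [gs [os ->]]]; exists 0, j, gs, os.
- case: b => /=; first by case=> i [gs [os ->]]; exists i.+1, gs, os.
  by case: (nilp cur) => //= -[gs [os ->]]; exists 0, gs, os.
- case: b => /=; first by case=> i [os ->]; exists (i :: os).
  by move=> ->; exists [::].
- case: b => /=; first by case=> i [os ->]; exists i.+1, os.
  by case: (nilp cur) => //= -[os ->]; exists 0, os.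
Qed.

Lemma scan_accepts x inst : accepts (scan x inst) ->
  exists C, [/\ encode_circuit C = inst, is_circuit (size x) (size (outputs C)) C &
                scan x inst = finished (eval C x)].
Proof.
move=> acc; have /= [C def_inst] := scan_parses acc.
by exists C; move: acc; rewrite def_inst scan_circuit; case: ifP.
Qed.

Definition scan_ctrl_index (q : scan_ctrl) : nat :=
  match q with
  | SizeBit => 0 | GateSep => 1 | Tag => 2 | NotOrConst => 3 | ConstBit => 4
  | NotIndex => 5 | OpBit => 6 | FirstIndex => 7 | SecondIndex => 8 | OutSep => 9
  | OutIndex => 10 | Finished => 11 | Failed => 12
  end.

#[export] Instance reg_scan_ctrl : reg scan_ctrl := reg_via reg_nat scan_ctrl_index.

Definition scan_tuple (st : scan_state) :=
  (ctrl st, wires st, cursor st, is_or st, operand st, outs st).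

#[export] Instance reg_scan_state : reg scan_state := reg_via _ scan_tuple.

Section ScanStatePT.

Context {A : Type} {rA : reg A}.

Lemma PT_eq_const_nat (n : A -> nat) (k : nat) : PT n -> PT (fun a => n a == k).
Proof.
move=> ptn; apply: PT_eq (PT_eq_word (PT_nseq ptn) (PT_const_word (nseq k true))) => a.
apply/eqP/eqP => [eq_n|->//]; by rewrite -(size_nseq (n a) true) eq_n size_nseq.
Qed.

Lemma PT_ScanState (q : A -> scan_ctrl) (vs cur : A -> word) (op c : A -> bool)
    (out : A -> word) :
  PT q -> PT vs -> PT cur -> PT op -> PT c -> PT out ->
  PT (fun a => ScanState (q a) (vs a) (cur a) (op a) (c a) (out a)).
Proof. by move=> *; apply: PT_to_via; rewrite /scan_tuple /=; pt. Qed.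

Lemma PT_const_scan_ctrl (q : scan_ctrl) : PT (fun _ : A => q).
Proof. by apply: PT_to_via; pt. Qed.

Section Projections.

Variables (st : A -> scan_state) (pt_st : PT st).

Let pt_tuple : PT (fun a => scan_tuple (st a)) := PT_comp (PT_via _ _) pt_st.

Lemma PT_ctrl : PT (fun a => ctrl (st a)).
Proof. exact: PT_fstE (PT_fstE (PT_fstE (PT_fstE (PT_fstE pt_tuple)))). Qed.
Lemma PT_wires : PT (fun a => wires (st a)).
Proof. exact: PT_sndE (PT_fstE (PT_fstE (PT_fstE (PT_fstE pt_tuple)))). Qed.
Lemma PT_cursor : PT (fun a => cursor (st a)).
Proof. exact: PT_sndE (PT_fstE (PT_fstE (PT_fstE pt_tuple))). Qed.
Lemma PT_is_or : PT (fun a => is_or (st a)).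
Proof. exact: PT_sndE (PT_fstE (PT_fstE pt_tuple)). Qed.
Lemma PT_operand : PT (fun a => operand (st a)).
Proof. exact: PT_sndE (PT_fstE pt_tuple). Qed.
Lemma PT_outs : PT (fun a => outs (st a)).
Proof. exact: PT_sndE pt_tuple. Qed.

End Projections.

Lemma PT_scan_ctrl_case (B : Type) (rB : reg B) (q : A -> scan_ctrl)
    (f0 f1 f2 f3 f4 f5 f6 f7 f8 f9 f10 f11 f12 : A -> B) :
  PT q -> PT f0 -> PT f1 -> PT f2 -> PT f3 -> PT f4 -> PT f5 -> PT f6 -> PT f7 ->
  PT f8 -> PT f9 -> PT f10 -> PT f11 -> PT f12 ->
  PT (fun a => match q a with
    | SizeBit => f0 a | GateSep => f1 a | Tag => f2 a | NotOrConst => f3 a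
    | ConstBit => f4 a | NotIndex => f5 a | OpBit => f6 a | FirstIndex => f7 a
    | SecondIndex => f8 a | OutSep => f9 a | OutIndex => f10 a
    | Finished => f11 a | Failed => f12 a end).
Proof.
move=> ptq *; have pti: PT (fun a => scan_ctrl_index (q a)).
  exact: PT_comp (PT_via _ _) ptq.
pose is_idx k a := scan_ctrl_index (q a) == k.
apply: (@PT_eq _ _ _ _ (fun a =>
  if is_idx 0 a then f0 a else if is_idx 1 a then f1 a else
  if is_idx 2 a then f2 a else if is_idx 3 a then f3 a else
  if is_idx 4 a then f4 a else if is_idx 5 a then f5 a else
  if is_idx 6 a then f6 a else if is_idx 7 a then f7 a else
  if is_idx 8 a then f8 a else if is_idx 9 a then f9 a else
  if is_idx 10 a then f10 a else if is_idx 11 a then f11 a else f12 a)).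
  by move=> a; rewrite /is_idx; case: (q a).
by do 12!(apply: PT_if; [exact: PT_eq_const_nat | by [] | ]).
Qed.

End ScanStatePT.

Ltac pt_user ::=
  lazymatch goal with
  | |- PT (fun a => rcons (@?w a) (@?b a)) => apply (PT_rcons (w := w) (b := b))
  | |- PT (fun a => @?v a ++ @?w a) => apply (PT_cat (v := v) (w := w))
  | |- PT (fun a => ctrl (@?s a)) => apply (PT_ctrl (st := s))
  | |- PT (fun a => wires (@?s a)) => apply (PT_wires (st := s))
  | |- PT (fun a => cursor (@?s a)) => apply (PT_cursor (st := s))
  | |- PT (fun a => is_or (@?s a)) => apply (PT_is_or (st := s))
  | |- PT (fun a => operand (@?s a)) => apply (PT_operand (st := s))
  | |- PT (fun a => outs (@?s a)) => apply (PT_outs (st := s))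
  | |- PT (fun a => ScanState (@?q a) (@?v a) (@?c a) (@?o a) (@?d a) (@?u a)) =>
    apply (PT_ScanState (q := q) (vs := v) (cur := c) (op := o) (c := d) (out := u))
  | |- _ => first [exact (PT_const_scan_ctrl _)
                 | apply PT_scan_ctrl_case]
  end.

Definition scan_bounded (c : nat) (st : scan_state) : bool :=
  [&& size (wires st) <= c, size (cursor st) <= c & size (outs st) <= c].

(** A letter completes at most one wire and at most one output, so the state grows linearly. *)
Lemma scan_step_bounded c st b :
  scan_bounded c st -> scan_bounded c.+1 (scan_step st b).
Proof.
rewrite /scan_bounded; case: st => q vs cur op a out /= /and3P[le_vs le_cur le_out].
rewrite /scan_step /=; case: q; case: b; rewrite //=; try (case: (nilp cur) => //=).
all: rewrite ?size_rcons ?size_behead; lia.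
Qed.

(** The control state, in unary, takes at most 12 and the two Boolean fields one each; three words
    remain. *)
Lemma rsize_scan_state c st : scan_bounded c st -> rsize st <= 14 + 3 * c.
Proof.
case/and3P=> le_vs le_cur le_out.
have -> : rsize st = rsize (scan_tuple st) by [].
rewrite !rsizeE /= [rsize (ctrl st)](_ : _ = scan_ctrl_index (ctrl st)); last exact: rsize_nat.
have : scan_ctrl_index (ctrl st) <= 12 by case: (ctrl st).
lia.
Qed.

Lemma PT_scan (A : Type) (rA : reg A) (x inst : A -> word) :
  PT x -> PT inst -> PT (fun a => scan (x a) (inst a)).
Proof.
move=> ptx pti; apply: (PT_foldl (step := fun _ => scan_step)
  (init := fun a => ScanState SizeBit (x a) (x a) false false [::])
  (Q := fun a => 14 + 3 * (rsize (x a) + rsize (inst a)))) => //.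
- by rewrite /scan_step /at_gate /at_output /finished /failed; pt.
- by pt.
- apply: poly_bounded_add (poly_bounded_const _) _.
  apply: poly_bounded_mul (poly_bounded_const _) _.
  by apply: poly_bounded_add; exact: PT_bound.
move=> a w1 w2 def_inst; apply: rsize_scan_state.
have le_w1: size w1 <= size (inst a) by rewrite def_inst size_cat leq_addr.
suff: scan_bounded (size (x a) + size w1)
   (foldl scan_step (ScanState SizeBit (x a) (x a) false false [::]) w1).
  by rewrite /scan_bounded !rsizeE => /and3P[*]; apply/and3P; split; lia.
elim/last_ind: w1 {def_inst le_w1} => [|w b IH]; first by rewrite /scan_bounded /= addn0 leqnn.
by rewrite foldl_rcons size_rcons addnS; exact: scan_step_bounded.
Qed.

(** * Folding the square of edges *)

(* The first bit of [u] tells whether [(u, v)] has to be complemented to bring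
   it into the half [u < 2^(n-1)] of the square; it is then dropped. *)
Definition fold_edge (y : word) : word := map (addb (head false y)) (behead y).

Lemma lexi_map_negb (u v : word) : size u = size v ->
  (map negb u <= map negb v :> seqlexi bool)%O = (v <= u :> seqlexi bool)%O.
Proof.
elim: u v => [|b u IH] [|c v] //= [sz].
by rewrite !Order.SeqLexiOrder.Exports.lexi_cons IH //; case: b; case: c.
Qed.

(** A zero fold means that every letter equals the first one: [y] is constant and its two halves
    coincide. *)
Lemma fold_edge0 (n m : nat) (y : word) : size y = n.+1 + n.+1 -> fold_edge y = nseq m false ->
  (drop n.+1 y <= take n.+1 y :> seqlexi bool)%O.
Proof.
case: y => [|b y] //= sz_y; rewrite /fold_edge /= => fold_y.
have def_y: y = nseq m b.
  rewrite -[LHS]map_id -(@eq_map _ _ (addb b \o addb b)) => [|c]; last by rewrite /= addbA addbb.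
  by rewrite map_comp fold_y map_nseq addbF.
have sz_m: m = n + n.+1 by move: sz_y; rewrite def_y size_nseq; lia.
rewrite def_y sz_m [X in (X <= _)%O](_ : _ = b :: nseq n b) ?take_nseq ?drop_nseq //.
  by rewrite leq_addr.
by rewrite addKn.
Qed.

Lemma fold_edge_eq (n : nat) (y z : word) :
  size y = n.+1 + n.+1 -> size z = n.+1 + n.+1 -> fold_edge y = fold_edge z ->
  [\/ y = z, (drop n.+1 y <= take n.+1 y :> seqlexi bool)%O |
      (drop n.+1 z <= take n.+1 z :> seqlexi bool)%O].
Proof.
move=> sz_y sz_z eq_yz.
(* Xoring with a bit is an involution, so each tail is recovered from the common fold and its first
   bit; everything depends on whether the first bits agree. *)
have [|compl]: y = z \/ z = map negb y.
  case: y z sz_y sz_z eq_yz => [|b y] [|c z] //= _ _; rewrite /fold_edge /= => eq_yz.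
  have def_z: z = map (addb (c (+) b)) y.
    rewrite -[LHS]map_id -(@eq_map _ _ (addb c \o addb c)) => [|d]; last by rewrite /= addbA addbb.
    rewrite map_comp -eq_yz -map_comp; apply: eq_map => d; by rewrite /= addbA.
  have [eq_bc|ne_bc] := eqVneq b c; [left|right]; rewrite def_z.
    rewrite eq_bc addbb; congr (_ :: _); by rewrite [RHS](_ : _ = map id y) ?map_id.
  have -> : c (+) b = true by case: b c ne_bc {eq_yz def_z} => [] [].
  by have -> : c = ~~ b by case: b c ne_bc {eq_yz def_z} => [] [].
- by constructor 1.
case: (boolP (drop n.+1 y <= take n.+1 y :> seqlexi bool)%O) => [|gt_uv]; first by constructor 2.
constructor 3; rewrite compl -map_drop -map_take lexi_map_negb.
  by move: gt_uv; rewrite -Order.TotalTheory.ltNge => /Order.POrderTheory.ltW.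
by rewrite size_drop size_takel sz_y ?addnK ?leq_addr.
Qed.

Lemma size_eval C x : size (eval C x) = size (outputs C).
Proof. exact: size_map. Qed.

Lemma turan_total (n : nat) (C : circuit) : 0 < n -> size (outputs C) = 2 * n ->
  (exists2 x, size x = 2 * n - 1 &
     ((edge n C x).1 >= (edge n C x).2 :> seqlexi bool)%O) \/
  (exists x y, [/\ size x = 2 * n - 1, size y = 2 * n - 1, x <> y & edge n C x = edge n C y]).
Proof.
case: n => // n _ sz_C; set m := 2 * n.+1 - 1.
have sz_y x : size (eval C x) = n.+1 + n.+1 by rewrite size_eval sz_C; lia.
case: (boolP [exists x : m.-tuple bool,
   ((edge n.+1 C x).1 >= (edge n.+1 C x).2 :> seqlexi bool)%O]) => [/existsP[x le_x]|/existsPn lt_all].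
  by left; exists x => //; exact: size_tuple.
have sz_fold x : size (fold_edge (eval C x)) == m.
  by rewrite size_map size_behead sz_y; apply/eqP; lia.
pose phi (x : m.-tuple bool) : m.-tuple bool := Tuple (sz_fold x).
(* An injective self-map of a finite set is onto and would reach the zero word, whose preimage is a
   pair with equal ends. *)
have not_inj: ~~ injectiveb phi.
  apply/negP => /injectiveP inj_phi.
  have [psi _ psiK] := injF_bij inj_phi.
  have := psiK (nseq_tuple m false) => /(congr1 val) /= /(fold_edge0 (sz_y _)) le_x.
  by case/negP: (lt_all (psi (nseq_tuple m false))).
case/injectivePn: not_inj => x [y ne_xy /(congr1 val) /= eq_xy].
right; exists x, y; split; try exact: size_tuple.
  by move/val_inj/eqP; exact/negP.
case: (fold_edge_eq (sz_y x) (sz_y y) eq_xy) => [eq_y|le_x|le_y].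
- by rewrite /edge eq_y.
- by case/negP: (lt_all x).
- by case/negP: (lt_all y).
Qed.

(** * Deciding weak-Turán *)

(** The leading unary block announces the number of inputs. Its ones serve as a test input of the
    right length and as a ruler for cutting solutions. *)
Definition input_ones (w : word) : word :=
  (foldl (fun s b => if s.1 && b then (true, true :: s.2) else (false, s.2))
     (true, [::]) w).2.

Lemma input_ones_encode m w : input_ones (encode_nat m ++ w) = nseq m true.
Proof.
rewrite /input_ones; set step := (fun _ _ => _).
have stop v : foldl step (false, v) w = (false, v) by elim: w.
have accum v : foldl step (true, v) (encode_nat m ++ w) = (false, nseq m true ++ v).
  elim: m v => [|m IH] v /=; first exact: stop.
  by rewrite /= IH; congr pair; elim: {IH} m => //= m ->.
by rewrite accum cats0.
Qed.

(** Every second letter is kept; only the resulting length matters. *)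
Definition half_word (w : word) : word :=
  (foldl (fun s b => (~~ s.1, if s.1 then b :: s.2 else s.2)) (false, [::]) w).2.

Lemma size_half_word w : size (half_word w) = (size w)./2.
Proof.
rewrite /half_word; set step := (fun _ _ => _).
have accum (s : bool * word) : size (foldl step s w).2 = size s.2 + (s.1 + size w)./2.
  elim: w s => [|b w IH] [c v] /=; first by case: c; rewrite /= addn0.
  by rewrite IH /=; case: c => /=; lia.
by rewrite accum.
Qed.

(** The state is a flag telling that the comparison is settled, the answer, and the rest of [u]. The
    initial answer [true] stands if [v] is exhausted first; at a difference [v] is smaller exactly
    when its letter is [false]. *)
Definition lexi_le (v u : word) : bool :=
  (foldl (fun s b =>
     if s.1.1 then s
     else if nilp s.2 then (true, false, [::])
     else if head false s.2 == b then (false, true, behead s.2)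
     else (true, ~~ b, [::])) (false, true, u) v).1.2.

Lemma lexi_leE v u : lexi_le v u = (v <= u :> seqlexi bool)%O.
Proof.
rewrite /lexi_le; set step := (fun _ _ => _).
have stop c w w' : foldl step (true, c, w) w' = (true, c, w) by elim: w'.
elim: v u => [|b v IH] [|c u] /=; rewrite ?stop //=.
by rewrite Order.SeqLexiOrder.Exports.lexi_cons; case: b; case: c; rewrite /= ?IH ?stop.
Qed.

(** Acceptance depends on the input only through its length, so one run checks the syntax. The
    number of inputs is of the form [2n - 1] with [n] positive exactly when it is odd, and there
    must be one more output. *)
Definition valid (inst : word) : bool :=
  let st := scan (input_ones inst) inst in
  [&& accepts st, odd (size (input_ones inst)) &
      size (outs st) == size (true :: input_ones inst)].

Lemma validP inst : valid inst -> exists n C,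
  [/\ 0 < n, is_circuit (2 * n - 1) (2 * n) C & encode_circuit C = inst].
Proof.
case/and3P=> /scan_accepts[C [def_inst ok_C ->]] odd_m /eqP /=.
rewrite size_eval => sz_C; exists (size (input_ones inst)).+1./2, C.
have def_m: 2 * (size (input_ones inst)).+1./2 = (size (input_ones inst)).+1 by lia.
by split=> //; [lia | rewrite def_m subn1 /= -sz_C].
Qed.

Section Valid.

Variables (n : nat) (C : circuit).
Hypotheses (n_gt0 : 0 < n) (ok_C : is_circuit (2 * n - 1) (2 * n) C).

Lemma valid_ones : input_ones (encode_circuit C) = nseq (2 * n - 1) true.
Proof.
by case/and4P: ok_C => /eqP eq_m _ _ _; rewrite /encode_circuit input_ones_encode eq_m.
Qed.

Lemma valid_scan x :
  scan x (encode_circuit C) = if size x == 2 * n - 1 then finished (eval C x) else failed.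
Proof.
rewrite scan_circuit; case/and4P: ok_C => /eqP eq_m /eqP eq_k ok_gs ok_os.
rewrite /is_circuit eq_m eqxx eq_sym; case: eqP => // ->.
by rewrite ok_gs ok_os.
Qed.

Lemma valid_encode : valid (encode_circuit C).
Proof.
rewrite /valid valid_ones valid_scan size_nseq eqxx /= size_eval.
case/and4P: ok_C => _ /eqP-> _ _.
have -> : 2 * n - 1 = n.-1.*2.+1 by rewrite mul2n; lia.
by rewrite /= odd_double size_nseq /=; apply/eqP; lia.
Qed.

(** The encoding is injective and the number of inputs determines [n], so the quantification over
    all readings of the instance collapses to one. *)
Lemma weak_turan_encode r s : weak_turan r (encode_circuit C) s <->
  exists2 xs, encodes_solution (2 * n - 1) s xs & weak_turan_solution r n C xs.
Proof.
split=> [/(_ n C n_gt0 ok_C erefl) //|sol n' C' n'_gt0 ok_C' /encode_circuit_inj def_C'].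
have <- // : n = n'; last by rewrite def_C'.
rewrite {C'}def_C' in ok_C'; case/and4P: ok_C => /eqP eq1 _ _ _.
by case/and4P: ok_C' => /eqP; rewrite eq1; lia.
Qed.

End Valid.

(** * Cutting a solution into strings, and recognizing cliques *)

Definition chunk (x0 s : word) (i : nat) : word :=
  take (size x0) (iter i (drop (size x0)) s).

Definition splits (x0 s : word) (k : nat) : bool :=
  all (fun i => size (chunk x0 s i) == size x0) (iota 0 k) &&
  nilp (iter k (drop (size x0)) s).

Lemma splitsP x0 s k : splits x0 s k ->
  encodes_solution (size x0) s (map (chunk x0 s) (iota 0 k)).
Proof.
case/andP=> sz_chunks /nilP last_s; split; last by rewrite all_map.
have: s = flatten [seq chunk x0 s i | i <- iota 0 k] ++ iter k (drop (size x0)) s.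
  elim: k {sz_chunks last_s} => [|k IH] //.
  by rewrite -addn1 iotaD map_cat flatten_cat addn1 /= cats0 -catA cat_take_drop.
by rewrite last_s cats0.
Qed.

Lemma splits_flatten x0 s xs : encodes_solution (size x0) s xs ->
  splits x0 s (size xs) /\ map (chunk x0 s) (iota 0 (size xs)) = xs.
Proof.
case=> -> {s} sz_xs.
have drops i : iter i (drop (size x0)) (flatten xs) = flatten (drop i xs).
  elim: i => [|i IH]; first by rewrite drop0.
  rewrite iterS IH; have [lt_i|le_i] := ltnP i (size xs).
    rewrite (drop_nth [::] lt_i) /= drop_size_cat //.
    by apply/eqP; apply: (allP sz_xs); exact: mem_nth.
  by rewrite !drop_oversize // ltnW.
have chunks i : i < size xs -> chunk x0 (flatten xs) i = nth [::] xs i.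
  move=> lt_i; rewrite /chunk drops (drop_nth [::] lt_i) /= take_size_cat //.
  by apply/eqP; apply: (allP sz_xs); exact: mem_nth.
split; last first.
  rewrite -[RHS](mkseq_nth [::]); apply/eq_in_map => i; rewrite mem_iota => /andP[_ lt_i].
  exact: chunks.
rewrite /splits drops drop_size andbT; apply/allP => i; rewrite mem_iota => /andP[_ lt_i].
by rewrite chunks //; apply: (allP sz_xs); exact: mem_nth.
Qed.

Definition cliqueb (es : seq (word * word)) (K : seq word) : bool :=
  [&& uniq K,
      all (fun e => [&& e.1 \in K, e.2 \in K & e.1 != e.2]) es &
      all (fun u => all (fun v =>
        (u != v) ==> (((u, v) \in es) || ((v, u) \in es))) K) K].

(* A clique with at least two vertices only has endpoints of edges. *)
Definition endpoint (N : nat) (e : nat -> word * word) (j : 'I_N * bool) : word :=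
  if j.2 then (e j.1).1 else (e j.1).2.

Definition has_clique (k N : nat) (e : nat -> word * word) : bool :=
  has (fun t : k.-tuple ('I_N * bool) =>
         cliqueb (map e (iota 0 N)) (map (endpoint e) t)) (enum {: k.-tuple ('I_N * bool)}).

Lemma has_cliqueP k N e : 1 < k ->
  reflect (edges_of_clique k (map e (iota 0 N))) (has_clique k N e).
Proof.
move=> k_gt1; apply: (iffP hasP) => [[t _ /and3P[uniq_K es_K /allP K_es]]|[K [uniq_K sz_K es_K K_es]]].
  exists (map (endpoint e) t); split=> //; first by rewrite size_map size_tuple.
    exact/allP.
  by move=> u v /K_es /allP u_es /u_es /implyP.
have endP u : u \in K -> exists j : 'I_N * bool, endpoint e j == u.
  move=> u_K; have [v v_K ne_uv]: exists2 v, v \in K & u != v.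
    case: K sz_K uniq_K u_K {es_K K_es} => [|x [|y K]] /=; try by move=> sz; rewrite -sz in k_gt1.
    move=> _ /and3P[]; rewrite !inE negb_or => /andP[ne_xy _] _ _ _.
    have [->|ne_ux] := eqVneq u x; first by exists y; rewrite // !inE eqxx orbT.
    by exists x; rewrite // inE eqxx.
  case/orP: (K_es u v u_K v_K ne_uv) => /mapP[i]; rewrite mem_iota => /andP[_ lt_i] def_e.
    by exists (Ordinal lt_i, true); rewrite /endpoint /= -def_e.
  by exists (Ordinal lt_i, false); rewrite /endpoint /= -def_e.
have [u u_K]: exists u, u \in K.
  by case: (K) sz_K k_gt1 => [<-|u K'] //; exists u; exact: mem_head.
have [j0 _] := endP u u_K.
(* [j0] is only the value outside [K]; each vertex of [K] is an endpoint by [endP]. *)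
pose f v := odflt j0 [pick j | endpoint e j == v].
have fK v : v \in K -> endpoint e (f v) = v.
  by rewrite /f; case: pickP => [j /eqP-> //|none] /endP[j]; rewrite none.
have sz_t : size (map f K) == k by rewrite size_map sz_K.
exists (Tuple sz_t); first by rewrite mem_enum.
have -> : map (endpoint e) (Tuple sz_t) = K.
  by rewrite /= -map_comp -[RHS]map_id; apply/eq_in_map => v; exact: fK.
apply/and3P; split=> //; first exact/allP.
by apply/allP => v v_K; apply/allP => w w_K; apply/implyP; exact: K_es.
Qed.

Definition scan_edge (inst x : word) : word * word :=
  let y := outs (scan x inst) in
  let h := half_word (true :: input_ones inst) in (take (size h) y, drop (size h) y).

Definition decide (r : nat) (inst s : word) : bool :=
  let x0 := input_ones inst in
  let x := chunk x0 s in
  let e i := scan_edge inst (x i) in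
  let N := (r * r.+1) %/ 2 in
  valid inst ==>
  [|| [&& splits x0 s N, uniq (map x (iota 0 N)) & has_clique r.+1 N e],
      splits x0 s 1 && lexi_le (e 0).2 (e 0).1 |
      [&& splits x0 s 2, x 0 != x 1 & outs (scan (x 0) inst) == outs (scan (x 1) inst)]].

Lemma decideP r inst s : 2 < r -> weak_turan r inst s <-> decide r inst s.
Proof.
move=> r_gt2; rewrite /decide; case: (boolP (valid inst)) => [val_inst|/negP inval]; last first.
  split=> // _ n C n_gt0 ok_C def_inst; case: inval; rewrite -def_inst.
  exact: valid_encode ok_C.
have [n [C [n_gt0 ok_C def_inst]]] := validP val_inst; rewrite implyTb -def_inst.
rewrite (valid_ones ok_C); set x0 := nseq _ true.
have sz_x0: size x0 = 2 * n - 1 by rewrite size_nseq.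
have scanE x : size x == size x0 -> outs (scan x (encode_circuit C)) = eval C x.
  by rewrite sz_x0 (valid_scan ok_C) => ->.
have edgeE x : size x == size x0 -> scan_edge (encode_circuit C) x = edge n C x.
  move=> sz_x; rewrite /scan_edge scanE // size_half_word /= (valid_ones ok_C) size_nseq.
  by have -> : uphalf (2 * n - 1) = n by lia.
have split_szs k i : splits x0 s k -> i < k -> size (chunk x0 s i) == size x0.
  by case/andP=> /allP all_sz _ lt_i; apply: all_sz; rewrite mem_iota.
have eq_eval x y : edge n C x = edge n C y <-> eval C x = eval C y.
  rewrite /edge; split=> [[eq1 eq2]|-> //].
  by rewrite -[LHS](cat_take_drop n) eq1 eq2 cat_take_drop.
have N_k k : splits x0 s k ->
    [seq scan_edge (encode_circuit C) (chunk x0 s i) | i <- iota 0 k] =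
    map (edge n C) (map (chunk x0 s) (iota 0 k)).
  move=> split_k; rewrite -map_comp; apply/eq_in_map => i; rewrite mem_iota => /andP[_ lt_i].
  by apply: edgeE; exact: split_szs lt_i.
rewrite (weak_turan_encode n_gt0 ok_C) -sz_x0; split=> [[xs enc_xs]|sol].
  have [split_xs def_xs] := splits_flatten enc_xs.
  case=> [[sz_xs uniq_xs clique_xs]|[i def_i le_i]|[i [j [def_ij ne_ij eq_ij]]]].
  - apply/or3P; constructor 1; rewrite -sz_xs split_xs def_xs uniq_xs /=.
    by apply/has_cliqueP; [lia | rewrite N_k // def_xs].
  - apply/or3P; constructor 2; rewrite def_i /= in split_xs def_xs.
    case: def_xs => def_xs; rewrite split_xs andTb lexi_leE edgeE ?(split_szs 1) //.
    by rewrite def_xs.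
  apply/or3P; constructor 3; rewrite def_ij /= in split_xs def_xs.
  case: def_xs => def0 def1; rewrite split_xs /= !scanE ?(split_szs 2) // def0 def1.
  by rewrite (introN eqP ne_ij) /=; apply/eqP/eq_eval.
case/or3P: sol => [/and3P[split_N uniq_N /has_cliqueP clique]|/andP[split1]|/and3P[split2 ne01]].
- exists (map (chunk x0 s) (iota 0 (r * r.+1 %/ 2))); first exact: splitsP.
  by constructor 1; split=> //; [rewrite size_map size_iota | rewrite -N_k //; apply: clique; lia].
- rewrite lexi_leE edgeE ?(split_szs 1) // => le_e.
  exists [:: chunk x0 s 0]; first exact: (splitsP split1).
  by constructor 2; exists (chunk x0 s 0).
rewrite !scanE ?(split_szs 2) // => /eqP/eq_eval eq01.
exists [:: chunk x0 s 0; chunk x0 s 1]; first exact: (splitsP split2).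
by constructor 3; exists (chunk x0 s 0), (chunk x0 s 1); split=> //; apply/eqP.
Qed.

Section DecidePT.

Context {A : Type} {rA : reg A}.

Lemma PT_odd_size (w : A -> word) : PT w -> PT (fun a => odd (size (w a))).
Proof.
move=> ptw; pose step (_ : A) (s : bool) (_ : bool) := ~~ s.
apply: (@PT_eq _ _ _ _ (fun a => foldl (step a) false (w a))).
  move=> a; rewrite -[RHS]addFb; elim: (w a) false => [|b v IH] c /=; first by rewrite addbF.
  by rewrite IH addbN addNb.
apply: (PT_foldl (Q := fun=> 1)) => //; rewrite /step; pt.
exact: poly_bounded_const.
Qed.

Lemma PT_input_ones (w : A -> word) : PT w -> PT (fun a => input_ones (w a)).
Proof.
move=> ptw; apply: PT_sndE.
apply: (PT_foldl (step := fun _ (s : bool * word) b => if s.1 && b then (true, true :: s.2) else (false, s.2))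
  (init := fun=> (true, [::])) (Q := fun a => (rsize (w a)).+1)) => //; pt.
  by apply: poly_bounded_S; exact: PT_bound.
move=> a w1 w2 ->; set step := (fun _ _ => _).
suff le s v : size (foldl step s v).2 <= size s.2 + size v.
  rewrite !rsizeE size_cat; have := le (true, [::]) w1 => /=; lia.
elim: v s => [|b v IH] s /=; first by rewrite addn0.
by apply: leq_trans (IH _) _; rewrite /step; case: ifP => _ /=; lia.
Qed.

Lemma PT_half_word (w : A -> word) : PT w -> PT (fun a => half_word (w a)).
Proof.
move=> ptw; apply: PT_sndE.
apply: (PT_foldl (step := fun _ (s : bool * word) b => (~~ s.1, if s.1 then b :: s.2 else s.2))
  (init := fun=> (false, [::])) (Q := fun a => (rsize (w a)).+1)) => //; pt.
  by apply: poly_bounded_S; exact: PT_bound.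
move=> a w1 w2 ->; set step := (fun _ _ => _).
suff le s v : size (foldl step s v).2 <= size s.2 + size v.
  rewrite !rsizeE size_cat; have := le (false, [::]) w1 => /=; lia.
elim: v s => [|b v IH] s /=; first by rewrite addn0.
by apply: leq_trans (IH _) _; rewrite /step; case: ifP => _ /=; lia.
Qed.

Lemma PT_lexi_le (v u : A -> word) : PT v -> PT u -> PT (fun a => lexi_le (v a) (u a)).
Proof.
move=> ptv ptu; apply: PT_sndE; apply: PT_fstE.
apply: (PT_foldl (step := fun _ (s : bool * bool * word) b =>
     if s.1.1 then s
     else if nilp s.2 then (true, false, [::])
     else if head false s.2 == b then (false, true, behead s.2)
     else (true, ~~ b, [::])) (init := fun a => (false, true, u a))
     (Q := fun a => (rsize (u a)).+2)) => //; pt.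
  by do 2!apply: poly_bounded_S; exact: PT_bound.
move=> a w1 w2 _; set step := (fun _ _ => _).
suff le s w : size (foldl step s w).2 <= size s.2.
  rewrite !rsizeE; have := le (false, true, u a) w1 => /=; lia.
elim: w s => [|b w IH] s //=.
apply: leq_trans (IH _) _; rewrite /step; do 3!case: ifP => _ //=.
by rewrite size_behead leq_pred.
Qed.

Lemma PT_mem (I : Type) (t : seq I) (z : I -> A -> word) (x : A -> word) :
  (forall i, PT (z i)) -> PT x -> PT (fun a => x a \in map (z^~ a) t).
Proof.
move=> ptz ptx; apply: PT_eq (PT_has t (fun i => PT_eq_word ptx (ptz i))) => a.
by elim: t => //= i t IH; rewrite inE IH.
Qed.

Lemma PT_uniq (I : Type) (t : seq I) (z : I -> A -> word) :
  (forall i, PT (z i)) -> PT (fun a => uniq (map (z^~ a) t)).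
Proof.
move=> ptz; elim: t => [|i t IH] /=; first exact: PT_const_bool.
exact: PT_andb (PT_negb (PT_mem _ ptz (ptz i))) IH.
Qed.

(** The index lists [se] and [sK] are fixed and only the entries depend on the argument, so all
    quantifiers unroll. *)
Lemma PT_cliqueb (I J : Type) (se : seq I) (sK : seq J) (e : I -> A -> word * word)
    (z : J -> A -> word) :
  (forall i, PT (e i)) -> (forall j, PT (z j)) ->
  PT (fun a => cliqueb (map (e^~ a) se) (map (z^~ a) sK)).
Proof.
move=> pte ptz; have pt1 i := PT_fstE (pte i); have pt2 i := PT_sndE (pte i).
have pt_edge u v : PT (fun a => (z u a, z v a) \in map (e^~ a) se).
  apply: PT_eq (PT_has se (fun i => PT_andb (PT_eq_word (ptz u) (pt1 i)) (PT_eq_word (ptz v) (pt2 i)))) => a.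
  by elim: se => //= i t IH; rewrite inE IH.
apply: PT_andb; first exact: PT_uniq.
apply: PT_andb.
  apply: (@PT_eq _ _ _ _ (fun a => all (fun i =>
    [&& (e i a).1 \in map (z^~ a) sK, (e i a).2 \in map (z^~ a) sK & (e i a).1 != (e i a).2]) se)).
    by move=> a; rewrite all_map.
  apply: PT_all => i; apply: PT_andb; first exact: PT_mem.
  by apply: PT_andb; [exact: PT_mem | exact: PT_negb (PT_eq_word _ _)].
apply: (@PT_eq _ _ _ _ (fun a => all (fun u => all (fun v => (z u a != z v a) ==>
  (((z u a, z v a) \in map (e^~ a) se) || ((z v a, z u a) \in map (e^~ a) se))) sK) sK)).
  by move=> a; rewrite all_map; apply: eq_all => u /=; rewrite all_map.
apply: PT_all => u; apply: PT_all => v.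
by apply: PT_implb; [exact: PT_negb (PT_eq_word _ _) | exact: PT_orb].
Qed.

Lemma PT_iter_drop (x0 s : A -> word) i :
  PT x0 -> PT s -> PT (fun a => iter i (drop (size (x0 a))) (s a)).
Proof. by move=> pt0 pts; elim: i => //= i IH; exact: PT_drop_size. Qed.

Lemma PT_chunk (x0 s : A -> word) i : PT x0 -> PT s -> PT (fun a => chunk (x0 a) (s a) i).
Proof. by move=> pt0 pts; apply: PT_take_size => //; exact: PT_iter_drop. Qed.

Lemma PT_splits (x0 s : A -> word) k : PT x0 -> PT s -> PT (fun a => splits (x0 a) (s a) k).
Proof.
move=> pt0 pts; apply: PT_andb; last by apply: PT_nilp; exact: PT_iter_drop.
by apply: PT_all => i; apply: PT_size_eq => //; exact: PT_chunk.
Qed.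

Lemma PT_accepts (st : A -> scan_state) : PT st -> PT (fun a => accepts (st a)).
Proof. by move=> pt_st; rewrite /accepts; apply: PT_scan_ctrl_case; pt. Qed.

Lemma PT_decide r (inst s : A -> word) :
  PT inst -> PT s -> PT (fun a => decide r (inst a) (s a)).
Proof.
move=> pti pts; have pt1 := PT_input_ones pti.
have pt_chunk i : PT (fun a => chunk (input_ones (inst a)) (s a) i) by exact: PT_chunk.
have pt_outs x : PT x -> PT (fun a => outs (scan (x a) (inst a))).
  by move=> ptx; apply: PT_outs; exact: PT_scan.
have pt_edge i : PT (fun a => scan_edge (inst a) (chunk (input_ones (inst a)) (s a) i)).
  have pth : PT (fun a => half_word (true :: input_ones (inst a))).
    by apply: PT_half_word; pt.
  by apply: PT_pair; [apply: PT_take_size | apply: PT_drop_size] => //; exact: pt_outs.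
apply: PT_implb.
  have pt_st := PT_scan pt1 pti.
  apply: PT_andb; first exact: PT_accepts.
  apply: PT_andb; first exact: PT_odd_size.
  by apply: PT_size_eq; [exact: PT_outs | pt].
apply: PT_orb.
  apply: PT_andb; first exact: PT_splits.
  apply: PT_andb; first exact: (PT_uniq _ pt_chunk).
  apply: PT_has => t; apply: PT_cliqueb => // j.
  by rewrite /endpoint; case: j.2; [exact: PT_fstE (pt_edge _) | exact: PT_sndE (pt_edge _)].
apply: PT_orb.
  apply: PT_andb; first exact: PT_splits.
  by apply: PT_lexi_le; [exact: PT_sndE (pt_edge 0) | exact: PT_fstE (pt_edge 0)].
apply: PT_andb; first exact: PT_splits.
apply: PT_andb; first exact: PT_negb (PT_eq_word (pt_chunk 0) (pt_chunk 1)).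
by apply: PT_eq_word; exact: pt_outs.
Qed.

End DecidePT.

(** * Folding the outputs of a circuit *)

(** Exclusive or as [(i || j) && ~~ (i && j)]. The gates become wires [w] to [w.+3], the last of
    which carries the result. *)
Definition xor_gadget (w i j : nat) : seq gate :=
  [:: And i j; Not w; Or i j; And w.+1 w.+2].

Fixpoint xor_gates (w i : nat) (js : seq nat) : seq gate :=
  if js is j :: js' then xor_gadget w i j ++ xor_gates w.+4 i js' else [::].

Fixpoint xor_outputs (w : nat) (js : seq nat) : seq nat :=
  if js is _ :: js' then w.+3 :: xor_outputs w.+4 js' else [::].

Definition fold_circuit (C : circuit) : circuit :=
  let w := inputs C + size (gates C) in
  let i := head 0 (outputs C) in let js := behead (outputs C) in
  Circuit (inputs C) (gates C ++ xor_gates w i js) (xor_outputs w js).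

Definition run_gates (vs : word) (gs : seq gate) : word :=
  foldl (fun vs g => rcons vs (gate_value vs g)) vs gs.

Lemma xor_gadget_value vs i j : i < size vs -> j < size vs ->
  exists u, run_gates vs (xor_gadget (size vs) i j) =
    (vs ++ u) ++ [:: nth false vs i (+) nth false vs j] /\ size u = 3.
Proof.
move=> lt_i lt_j; set a := nth false vs i; set b := nth false vs j.
exists [:: a && b; ~~ (a && b); a || b]; split=> //.
have lt_S k n : k < n -> k < n.+1 by exact: ltnW.
rewrite /run_gates /= !nth_rcons !size_rcons !ltnSn !ltnn !eqxx.
rewrite lt_i lt_j !lt_S // -/a -/b -!cats1 -!catA /=.
by case: a; case: b.
Qed.

(** New wires are only appended, so [i] and the remaining [js], which point below [size vs], keep
    their values through the induction. *)
Lemma xor_gates_value vs i js : i < size vs -> all (fun j => j < size vs) js ->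
  let vs' := run_gates vs (xor_gates (size vs) i js) in
  (exists u, vs' = vs ++ u) /\
  map (nth false vs') (xor_outputs (size vs) js) =
  map (fun j => nth false vs i (+) nth false vs j) js.
Proof.
move=> lt_i; elim: js vs lt_i => [|j js IH] vs lt_i.
  by split=> //; exists [::]; rewrite cats0.
case/andP=> lt_j; rewrite -/(all _ _) => lt_js vs'.
have {vs'}-> : vs' = run_gates (run_gates vs (xor_gadget (size vs) i j))
                               (xor_gates (size vs).+4 i js) by [].
have -> : xor_outputs (size vs) (j :: js) =
  (size vs).+3 :: xor_outputs (size vs).+4 js by [].
rewrite !map_cons.
have [u [-> sz_u]] := xor_gadget_value lt_i lt_j.
set b := nth _ _ _ (+) _; set vs1 := _ ++ [:: b].
have sz1: size vs1 = (size vs).+4 by rewrite !size_cat /= sz_u; lia.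
have nth1 k : k < size vs -> nth false vs1 k = nth false vs k.
  by move=> lt_k; rewrite /vs1 -catA nth_cat lt_k.
have [||[v def_v] eq_out] := IH vs1.
- lia.
- by apply: sub_all lt_js => k /=; lia.
rewrite sz1 in def_v eq_out; split; first by exists (u ++ b :: v); rewrite def_v /vs1 -!catA.
congr (_ :: _); last first.
  rewrite eq_out nth1 //; apply/eq_in_map => k k_js; rewrite nth1 //.
  exact: (allP lt_js).
rewrite def_v nth_cat sz1 ltnS leqnn /vs1 nth_cat size_cat sz_u.
have -> : (size vs).+3 < size vs + 3 = false by lia.
by have -> : (size vs).+3 - (size vs + 3) = 0 by lia.
Qed.

Lemma gates_ok_cat w gs hs : gates_ok w (gs ++ hs) = gates_ok w gs && gates_ok (w + size gs) hs.
Proof.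
by elim: gs w => [|g gs IH] w /=; rewrite ?addn0 // IH addSnnS andbA.
Qed.

Lemma xor_gates_ok w i js : i < w -> all (fun j => j < w) js -> gates_ok w (xor_gates w i js).
Proof.
elim: js w => [|j js IH] w //= lt_i /andP[lt_j lt_js].
rewrite lt_j lt_i IH ?andbT /=; [lia | lia | by apply: sub_all lt_js => k; lia].
Qed.

Lemma size_xor_gates w i js : size (xor_gates w i js) = 4 * size js.
Proof. by elim: js w => //= j js IH w; rewrite IH; lia. Qed.

Lemma xor_outputs_ok w js :
  (size (xor_outputs w js) == size js) &&
  all (fun j => j < w + 4 * size js) (xor_outputs w js).
Proof.
elim: js w => //= j js IH w; have /andP[/eqP-> ok] := IH w.+4.
rewrite eqxx /=; apply/andP; split; first lia.
by apply: sub_all ok => k; lia.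
Qed.

Lemma fold_circuit_ok m k C : is_circuit m k.+1 C -> is_circuit m k (fold_circuit C).
Proof.
case/and4P=> /eqP def_m; case: C def_m => m' gs [|i js] //= -> /eqP[sz_js] ok_gs /andP[lt_i lt_js].
have /andP[/eqP sz_out ok_out] := xor_outputs_ok (m + size gs) js.
rewrite /is_circuit /= eqxx sz_out sz_js eqxx gates_ok_cat ok_gs xor_gates_ok //=.
by rewrite size_cat size_xor_gates addnA.
Qed.

Lemma eval_fold_circuit m k C x : is_circuit m k.+1 C -> size x = m ->
  eval (fold_circuit C) x = fold_edge (eval C x).
Proof.
case/and4P=> /eqP def_m; case: C def_m => m' gs [|i js] //= -> _ _ /andP[lt_i lt_js] sz_x.
rewrite /eval /= foldl_cat -!/(run_gates _ _).
have sz_vs : size (run_gates x gs) = m + size gs by rewrite size_run_gates sz_x.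
rewrite -sz_vs in lt_i lt_js *.
have [_ ->] := xor_gates_value lt_i lt_js.
by rewrite /fold_edge /= -map_comp.
Qed.

(** * The reduction on encodings *)

(** States of a one-pass transducer. The new gates belong before the outputs but become known only
    when these are read; hence two accumulators, the gate list being left without its terminator
    until the end. *)
Variant fold_ctrl :=
  | CopySize | CopySep | CopyTag | CopyNotOrConst | CopyConst | CopyOp
  | CopyFirst | CopyLast | HeadSep | HeadIndex | NextSep | NextIndex | Done.

Record fold_state := FoldState {
  fctrl : fold_ctrl;
  wire_count : nat;
  head_index : nat;
  next_index : nat;
  gate_code : word;
  output_code : word
}.

(** [encode_seq] without its terminator, so that appending lists is concatenation of codes. *)
Definition items (T : Type) (e : T -> word) (s : seq T) : word :=
  flatten [seq true :: e a | a <- s].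

Lemma encode_seqE (T : Type) (e : T -> word) s : encode_seq e s = items e s ++ [:: false].
Proof. by elim: s => //= a s ->; rewrite /items /= -catA. Qed.

(** [wire_count] goes up with every input and every copied gate, so it is the first free wire when
    the outputs begin. [CopyLast] serves both the index of a [Not] and the second index of a binary
    gate. *)
Definition fold_step (st : fold_state) (b : bool) : fold_state :=
  let w := wire_count st in let i := head_index st in let j := next_index st in
  let gc := gate_code st in let oc := output_code st in
  match fctrl st with
  | CopySize => if b then FoldState CopySize w.+1 0 0 (rcons gc b) [::]
                else FoldState CopySep w 0 0 (rcons gc b) [::]
  | CopySep => if b then FoldState CopyTag w.+1 0 0 (rcons gc b) [::]
               else FoldState HeadSep w 0 0 gc [::]
  | CopyTag => FoldState (if b then CopyOp else CopyNotOrConst) w 0 0 (rcons gc b) [::]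
  | CopyNotOrConst =>
      FoldState (if b then CopyLast else CopyConst) w 0 0 (rcons gc b) [::]
  | CopyConst => FoldState CopySep w 0 0 (rcons gc b) [::]
  | CopyOp => FoldState CopyFirst w 0 0 (rcons gc b) [::]
  | CopyFirst => FoldState (if b then CopyFirst else CopyLast) w 0 0 (rcons gc b) [::]
  | CopyLast => FoldState (if b then CopyLast else CopySep) w 0 0 (rcons gc b) [::]
  | HeadSep => if b then FoldState HeadIndex w 0 0 gc [::] else FoldState Done w 0 0 gc [::]
  | HeadIndex => if b then FoldState HeadIndex w i.+1 0 gc [::]
                 else FoldState NextSep w i 0 gc [::]
  | NextSep => if b then FoldState NextIndex w i 0 gc oc else FoldState Done w i 0 gc oc
  | NextIndex =>
      if b then FoldState NextIndex w i j.+1 gc oc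
      else FoldState NextSep w.+4 i 0 (gc ++ items encode_gate (xor_gadget w i j))
                     (oc ++ true :: encode_nat w.+3)
  | Done => st
  end.

Definition fold_code (inst : word) : word :=
  let st := foldl fold_step (FoldState CopySize 0 0 0 [::] [::]) inst in
  gate_code st ++ false :: output_code st ++ [:: false].

Lemma fold_cons st b v :
  foldl fold_step st (b :: v) = foldl fold_step (fold_step st b) v.
Proof. by []. Qed.

Lemma fold_copy_size w gc m v :
  foldl fold_step (FoldState CopySize w 0 0 gc [::]) (encode_nat m ++ v) =
  foldl fold_step (FoldState CopySep (w + m) 0 0 (gc ++ encode_nat m) [::]) v.
Proof.
elim: m w gc => [|m IH] w gc /=; first by rewrite addn0 cats1.
by rewrite [fold_step _ _]/= IH addSnnS cat_rcons.
Qed.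

Lemma fold_copy_last w gc m v :
  foldl fold_step (FoldState CopyLast w 0 0 gc [::]) (encode_nat m ++ v) =
  foldl fold_step (FoldState CopySep w 0 0 (gc ++ encode_nat m) [::]) v.
Proof.
elim: m gc => [|m IH] gc /=; first by rewrite cats1.
by rewrite [fold_step _ _]/= IH cat_rcons.
Qed.

Lemma fold_copy_first w gc m v :
  foldl fold_step (FoldState CopyFirst w 0 0 gc [::]) (encode_nat m ++ v) =
  foldl fold_step (FoldState CopyLast w 0 0 (gc ++ encode_nat m) [::]) v.
Proof.
elim: m gc => [|m IH] gc /=; first by rewrite cats1.
by rewrite [fold_step _ _]/= IH cat_rcons.
Qed.

Lemma fold_copy_gates w gc gs v :
  foldl fold_step (FoldState CopySep w 0 0 gc [::]) (encode_seq encode_gate gs ++ v) =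
  foldl fold_step (FoldState HeadSep (w + size gs) 0 0 (gc ++ items encode_gate gs) [::]) v.
Proof.
elim: gs w gc => [|g gs IH] w gc; first by rewrite /= addn0 cats0.
rewrite [encode_seq _ _]/= -/(encode_seq _ gs) /items /= -/(items _ gs) -addSnnS.
have -> : gc ++ true :: encode_gate g ++ items encode_gate gs =
  (rcons gc true ++ encode_gate g) ++ items encode_gate gs by rewrite -cats1 -!catA.
have step_sep w1 gc1 : fold_step (FoldState CopySep w1 0 0 gc1 [::]) true =
  FoldState CopyTag w1.+1 0 0 (rcons gc1 true) [::] by [].
have step_tag b w1 gc1 : fold_step (FoldState CopyTag w1 0 0 gc1 [::]) b =
  FoldState (if b then CopyOp else CopyNotOrConst) w1 0 0 (rcons gc1 b) [::] by [].
have step_not b w1 gc1 : fold_step (FoldState CopyNotOrConst w1 0 0 gc1 [::]) b =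
  FoldState (if b then CopyLast else CopyConst) w1 0 0 (rcons gc1 b) [::] by [].
have step_const b w1 gc1 : fold_step (FoldState CopyConst w1 0 0 gc1 [::]) b =
  FoldState CopySep w1 0 0 (rcons gc1 b) [::] by [].
have step_op b w1 gc1 : fold_step (FoldState CopyOp w1 0 0 gc1 [::]) b =
  FoldState CopyFirst w1 0 0 (rcons gc1 b) [::] by [].
rewrite -IH -catA step_sep; move: (_ ++ v) => v1.
case: g => [b|i|i j|i j]; rewrite [encode_gate _]/= -?/(encode_nat _).
- by rewrite !cat_cons !fold_cons step_tag step_not step_const -!cats1 -!catA.
- by rewrite !cat_cons !fold_cons step_tag step_not fold_copy_last -!cats1 -!catA.
- by rewrite !cat_cons -catA !fold_cons step_tag step_op fold_copy_first fold_copy_last -!cats1 -!catA.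
- by rewrite !cat_cons -catA !fold_cons step_tag step_op fold_copy_first fold_copy_last -!cats1 -!catA.
Qed.

Lemma fold_head_index w k gc i v :
  foldl fold_step (FoldState HeadIndex w k 0 gc [::]) (encode_nat i ++ v) =
  foldl fold_step (FoldState NextSep w (k + i) 0 gc [::]) v.
Proof.
elim: i k => [|i IH] k /=; first by rewrite addn0.
by rewrite [fold_step _ _]/= IH addSnnS.
Qed.

Lemma fold_next_index w i k gc oc j v :
  foldl fold_step (FoldState NextIndex w i k gc oc) (encode_nat j ++ v) =
  foldl fold_step (FoldState NextSep w.+4 i 0
    (gc ++ items encode_gate (xor_gadget w i (k + j)))
    (oc ++ true :: encode_nat w.+3)) v.
Proof.
elim: j k => [|j IH] k /=; first by rewrite addn0.
by rewrite [fold_step _ _]/= IH addSnnS.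
Qed.

Lemma fold_next w i gc oc js :
  let st := foldl fold_step (FoldState NextSep w i 0 gc oc) (encode_seq encode_nat js) in
  gate_code st = gc ++ items encode_gate (xor_gates w i js) /\
  output_code st = oc ++ items encode_nat (xor_outputs w js).
Proof.
elim: js w gc oc => [|j js IH] w gc oc; first by rewrite /items /= !cats0.
rewrite [encode_seq _ _]/= -/(encode_seq _ js) [foldl _ _ _]/= {1}/fold_step /= fold_next_index.
have [-> ->] := IH w.+4 (gc ++ items encode_gate (xor_gadget w i (0 + j)))
  (oc ++ true :: encode_nat w.+3).
by rewrite -!catA add0n.
Qed.

Lemma fold_code_encode C : 0 < size (outputs C) ->
  fold_code (encode_circuit C) = encode_circuit (fold_circuit C).
Proof.
case: C => m gs [|i js] //= _.
rewrite /fold_code /encode_circuit fold_copy_size fold_copy_gates /=.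
rewrite {1 2}/fold_step /= fold_head_index !add0n.
have [-> ->] := fold_next (m + size gs) i ([::] ++ encode_nat m ++ items encode_gate gs) [::] js.
rewrite !encode_seqE /fold_circuit /= /items map_cat flatten_cat.
by rewrite -!catA.
Qed.

Definition fold_ctrl_index (q : fold_ctrl) : nat :=
  match q with
  | CopySize => 0 | CopySep => 1 | CopyTag => 2 | CopyNotOrConst => 3
  | CopyConst => 4 | CopyOp => 5 | CopyFirst => 6 | CopyLast => 7 | HeadSep => 8
  | HeadIndex => 9 | NextSep => 10 | NextIndex => 11 | Done => 12
  end.

#[export] Instance reg_fold_ctrl : reg fold_ctrl := reg_via reg_nat fold_ctrl_index.

Definition fold_tuple (st : fold_state) :=
  (fctrl st, wire_count st, head_index st, next_index st, gate_code st, output_code st).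

#[export] Instance reg_fold_state : reg fold_state := reg_via _ fold_tuple.

Section FoldPT.

Context {A : Type} {rA : reg A}.

Lemma PT_FoldState (q : A -> fold_ctrl) (w i j : A -> nat) (gc oc : A -> word) :
  PT q -> PT w -> PT i -> PT j -> PT gc -> PT oc ->
  PT (fun a => FoldState (q a) (w a) (i a) (j a) (gc a) (oc a)).
Proof. by move=> *; apply: PT_to_via; rewrite /fold_tuple /=; pt. Qed.

Lemma PT_const_fold_ctrl (q : fold_ctrl) : PT (fun _ : A => q).
Proof. by apply: PT_to_via; pt. Qed.

Section Projections.

Variables (st : A -> fold_state) (pt_st : PT st).

Let pt_tuple : PT (fun a => fold_tuple (st a)) := PT_comp (PT_via _ _) pt_st.

Lemma PT_fctrl : PT (fun a => fctrl (st a)).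
Proof. exact: PT_fstE (PT_fstE (PT_fstE (PT_fstE (PT_fstE pt_tuple)))). Qed.
Lemma PT_wire_count : PT (fun a => wire_count (st a)).
Proof. exact: PT_sndE (PT_fstE (PT_fstE (PT_fstE (PT_fstE pt_tuple)))). Qed.
Lemma PT_head_index : PT (fun a => head_index (st a)).
Proof. exact: PT_sndE (PT_fstE (PT_fstE (PT_fstE pt_tuple))). Qed.
Lemma PT_next_index : PT (fun a => next_index (st a)).
Proof. exact: PT_sndE (PT_fstE (PT_fstE pt_tuple)). Qed.
Lemma PT_gate_code : PT (fun a => gate_code (st a)).
Proof. exact: PT_sndE (PT_fstE pt_tuple). Qed.
Lemma PT_output_code : PT (fun a => output_code (st a)).
Proof. exact: PT_sndE pt_tuple. Qed.

End Projections.

Lemma PT_fold_ctrl_case (B : Type) (rB : reg B) (q : A -> fold_ctrl)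
    (f0 f1 f2 f3 f4 f5 f6 f7 f8 f9 f10 f11 f12 : A -> B) :
  PT q -> PT f0 -> PT f1 -> PT f2 -> PT f3 -> PT f4 -> PT f5 -> PT f6 -> PT f7 ->
  PT f8 -> PT f9 -> PT f10 -> PT f11 -> PT f12 ->
  PT (fun a => match q a with
    | CopySize => f0 a | CopySep => f1 a | CopyTag => f2 a | CopyNotOrConst => f3 a
    | CopyConst => f4 a | CopyOp => f5 a | CopyFirst => f6 a | CopyLast => f7 a
    | HeadSep => f8 a | HeadIndex => f9 a | NextSep => f10 a
    | NextIndex => f11 a | Done => f12 a end).
Proof.
move=> ptq *; have pti: PT (fun a => fold_ctrl_index (q a)).
  exact: PT_comp (PT_via _ _) ptq.
pose is_idx k a := fold_ctrl_index (q a) == k.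
apply: (@PT_eq _ _ _ _ (fun a =>
  if is_idx 0 a then f0 a else if is_idx 1 a then f1 a else
  if is_idx 2 a then f2 a else if is_idx 3 a then f3 a else
  if is_idx 4 a then f4 a else if is_idx 5 a then f5 a else
  if is_idx 6 a then f6 a else if is_idx 7 a then f7 a else
  if is_idx 8 a then f8 a else if is_idx 9 a then f9 a else
  if is_idx 10 a then f10 a else if is_idx 11 a then f11 a else f12 a)).
  by move=> a; rewrite /is_idx; case: (q a).
by do 12!(apply: PT_if; [exact: PT_eq_const_nat | by [] | ]).
Qed.

Lemma PT_encode_nat (n : A -> nat) : PT n -> PT (fun a => encode_nat (n a)).
Proof. by move=> ptn; apply: PT_cat (PT_nseq ptn) (PT_const_word _). Qed.

Lemma PT_items_xor_gadget (w i j : A -> nat) : PT w -> PT i -> PT j ->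
  PT (fun a => items encode_gate (xor_gadget (w a) (i a) (j a))).
Proof.
move=> ptw pti ptj.
have pt2 b n m : PT n -> PT m -> PT (fun a => [:: true; true; b] ++ (encode_nat (n a) ++ encode_nat (m a))).
  move=> ptn ptm; apply: PT_cat (PT_const_word _) _.
  by apply: PT_cat; exact: PT_encode_nat.
have pt1 : PT (fun a => [:: true; false; true] ++ encode_nat (w a)).
  by apply: PT_cat (PT_const_word _) _; exact: PT_encode_nat.
have ptw1 := PT_succ ptw.
have pt_all := PT_cat (pt2 false _ _ pti ptj) (PT_cat pt1 (PT_cat (pt2 true _ _ pti ptj)
  (pt2 false _ _ ptw1 (PT_succ ptw1)))).
by apply: PT_eq pt_all => a; rewrite /items /= cats0.
Qed.

End FoldPT.

Ltac pt_fold :=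
  lazymatch goal with
  | |- PT (fun a => fctrl (@?s a)) => apply (PT_fctrl (st := s))
  | |- PT (fun a => wire_count (@?s a)) => apply (PT_wire_count (st := s))
  | |- PT (fun a => head_index (@?s a)) => apply (PT_head_index (st := s))
  | |- PT (fun a => next_index (@?s a)) => apply (PT_next_index (st := s))
  | |- PT (fun a => gate_code (@?s a)) => apply (PT_gate_code (st := s))
  | |- PT (fun a => output_code (@?s a)) => apply (PT_output_code (st := s))
  | |- PT (fun a => encode_nat (@?n a)) => apply (PT_encode_nat (n := n))
  | |- PT (fun a => items encode_gate (xor_gadget (@?w a) (@?i a) (@?j a))) =>
    apply (PT_items_xor_gadget (w := w) (i := i) (j := j))
  | |- PT (fun a => FoldState (@?q a) (@?w a) (@?i a) (@?j a) (@?g a) (@?o a)) =>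
    apply (PT_FoldState (q := q) (w := w) (i := i) (j := j) (gc := g) (oc := o))
  | |- _ => first [exact (PT_const_fold_ctrl _) | apply PT_fold_ctrl_case | pt_step]
  end.

Lemma size_encode_nat n : size (encode_nat n) = n.+1.
Proof. by rewrite size_cat size_nseq addn1. Qed.

Lemma size_items_xor_gadget w i j :
  size (items encode_gate (xor_gadget w i j)) = 3 * w + 2 * i + 2 * j + 22.
Proof.
by rewrite /items /= /encode_nat; do 8!rewrite ?size_cat ?size_nseq /=; lia.
Qed.

(* This holds after [k] steps: a step writes at most [20 * k + 27] bits. *)
Definition fold_bounded (k : nat) (st : fold_state) : bool :=
  [&& wire_count st <= 4 * k, head_index st <= k, next_index st <= k &
      size (gate_code st) + size (output_code st) <= k * (20 * k + 27)].

Lemma fold_step_bounded k st b : fold_bounded k st -> fold_bounded k.+1 (fold_step st b).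
Proof.
rewrite /fold_bounded; case: st => q w i j gc oc /= /and4P[le_w le_i le_j le_code].
(* With [w <= 4 * k] and [i, j <= k], a gadget takes at most [16 * k + 22] bits and its output at
   most [4 * k + 5]. *)
have le_code' : size gc + size oc + (20 * k + 27) <= k.+1 * (20 * k.+1 + 27) by nia.
have sz_out : size (true :: encode_nat w.+3) = w + 5 by rewrite /= size_encode_nat; lia.
have sz_nil : size ([::] : word) = 0 by [].
case: q; case: b; rewrite /fold_step;
  cbn [fctrl wire_count head_index next_index gate_code output_code].
all: rewrite ?size_rcons ?(size_cat gc) ?(size_cat oc) ?size_items_xor_gadget ?sz_out ?sz_nil; lia.
Qed.

(** At most 12 for the control state; the three counters, stored in unary, contribute
    [4 * k + k + k]. *)
Lemma rsize_fold_state k st : fold_bounded k st -> rsize st <= 12 + 6 * k + k * (20 * k + 27).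
Proof.
case/and4P=> le_w le_i le_j le_code.
have -> : rsize st = rsize (fold_tuple st) by [].
rewrite !rsizeE /= [rsize (fctrl st)](_ : _ = fold_ctrl_index (fctrl st)); last exact: rsize_nat.
have : fold_ctrl_index (fctrl st) <= 12 by case: (fctrl st).
lia.
Qed.

Lemma PT_fold_code : PT fold_code.
Proof.
have pt_state : PT (fun inst => foldl fold_step (FoldState CopySize 0 0 0 [::] [::]) inst).
  apply: (PT_foldl (step := fun _ => fold_step)
    (init := fun=> FoldState CopySize 0 0 0 [::] [::])
    (Q := fun inst : word => 12 + 6 * rsize inst + rsize inst * (20 * rsize inst + 27))).
  - by rewrite /fold_step; repeat pt_fold.
  - by repeat pt_fold.
  - exact: PT_id.
  - do !first [exact: poly_bounded_rsize | exact: poly_bounded_const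
      | apply: poly_bounded_add | apply: poly_bounded_mul].
  move=> inst w1 w2 def_inst.
  have le_w1 : size w1 <= rsize inst by rewrite def_inst rsize_word size_cat leq_addr.
  apply: leq_trans (rsize_fold_state (k := size w1) _) _; last by nia.
  elim/last_ind: w1 {def_inst le_w1} => // w b IH.
  by rewrite foldl_rcons size_rcons; exact: fold_step_bounded.
by rewrite /fold_code; repeat pt_fold.
Qed.

(** * Membership in PPP *)

(** The first test settles invalid instances, zeros and pairs with equal edges. Otherwise [s]
    consists of two inputs of equal length, one of which is a solution by itself. *)
Definition unfold_solution (r : nat) (inst s : word) : word :=
  let h := half_word s in
  if decide r inst s then s
  else if decide r inst (take (size h) s) then take (size h) s
  else drop (size h) s.

Lemma PT_unfold_solution r : PT (fun x : word * word => unfold_solution r x.1 x.2).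
Proof.
have pth : PT (fun x : word * word => half_word x.2) by apply: PT_half_word; pt.
have ptt := PT_take_size pth PT_snd; have ptd := PT_drop_size pth PT_snd.
apply: PT_if; first by apply: PT_decide; pt.
  by pt.
by apply: PT_if => //; apply: PT_decide; pt.
Qed.

Lemma weak_turan_descent r n C x : 0 < n -> is_circuit (2 * n - 1) (2 * n) C ->
  size x = 2 * n - 1 -> ((edge n C x).1 >= (edge n C x).2 :> seqlexi bool)%O ->
  weak_turan r (encode_circuit C) x.
Proof.
move=> n_gt0 ok_C sz_x le_x; apply/(weak_turan_encode n_gt0 ok_C).
exists [:: x]; first by split; rewrite /= ?cats0 ?sz_x ?eqxx.
by constructor 2; exists x.
Qed.

Lemma weak_turan_collision r n C x y : 0 < n -> is_circuit (2 * n - 1) (2 * n) C ->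
  size x = 2 * n - 1 -> size y = 2 * n - 1 -> x <> y -> edge n C x = edge n C y ->
  weak_turan r (encode_circuit C) (x ++ y).
Proof.
move=> n_gt0 ok_C sz_x sz_y ne_xy eq_xy; apply/(weak_turan_encode n_gt0 ok_C).
exists [:: x; y]; first by split; rewrite /= ?cats0 ?sz_x ?sz_y ?eqxx.
by constructor 3; exists x, y.
Qed.

Lemma weak_turan_TFNP r : 2 < r -> TFNP (weak_turan r).
Proof.
move=> r_gt2; split.
  exists (decide r); split=> [inst s|]; first exact: decideP.
  by apply: PT_polytime2; apply: PT_cons (PT_const_word _); apply: PT_decide; pt.
(* A solution takes at most two strings of [2n - 1] bits, and this number is written in unary in the
   instance. *)
exists (2%:P * ('X + 1) ^+ 1)%R => inst; rewrite horner_monomial.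
case: (boolP (valid inst)) => [/validP[n [C [n_gt0 ok_C <-]]]|/negP inval]; last first.
  by exists [::] => // n C n_gt0 ok_C def_inst; case: inval; rewrite -def_inst; exact: valid_encode ok_C.
have /and4P[/eqP def_m /eqP sz_C _ _] := ok_C.
have le_m : 2 * n - 1 <= size (encode_circuit C).
  by rewrite /encode_circuit size_cat size_encode_nat def_m; lia.
case: (turan_total n_gt0 sz_C) => [[x sz_x le_x]|[x [y [sz_x sz_y ne_xy eq_xy]]]].
  by exists x; [exact: weak_turan_descent le_x | lia].
by exists (x ++ y); [exact: weak_turan_collision eq_xy | rewrite size_cat; lia].
Qed.

Lemma weak_turan_reducible r : 2 < r -> reducible (weak_turan r) pigeon.
Proof.
move=> r_gt2; exists fold_code, (unfold_solution r); split.
- exact: PT_polytime1 PT_fold_code.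
- exact: PT_polytime2 (PT_unfold_solution r).
move=> inst s; rewrite /unfold_solution.
case: ifP => [dec_s _|/negP not_s]; first exact/decideP.
case: (boolP (valid inst)) => [/validP[n [C [n_gt0 ok_C def_inst]]]|inval]; last first.
  by case: not_s; rewrite /decide (negPf inval).
rewrite -{}def_inst in not_s *; have /and4P[_ /eqP sz_C _ _] := ok_C.
case: n => // n in n_gt0 ok_C sz_C *; set m := 2 * n.+1 - 1 in ok_C.
have sz_y x : size (eval C x) = n.+1 + n.+1 by rewrite size_eval sz_C; lia.
have ok_C' : is_circuit m m.+1 C by rewrite (_ : m.+1 = 2 * n.+1) //; lia.
rewrite fold_code_encode ?sz_C // => /(_ m _ (fold_circuit_ok ok_C') erefl).
case=> xs [def_s sz_xs]; rewrite {s}def_s in not_s *.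
case=> [[x def_xs eval0]|[x [y [def_xs ne_xy eq_xy]]]].
  rewrite {}def_xs /= cats0 andbT in sz_xs not_s *; have {}sz_xs := eqP sz_xs.
  (* A zero already solves the instance, against the rejection of [s]. *)
  case: not_s; apply/decideP => //; apply: (weak_turan_descent r n_gt0 ok_C) => //.
  apply: (fold_edge0 (sz_y x) (m := m)).
  by rewrite -eval0 (eval_fold_circuit ok_C').
rewrite {}def_xs /= cats0 andbT in sz_xs not_s *.
case/andP: sz_xs => /eqP sz_x /eqP sz_y'.
have sz_h : size (half_word (x ++ y)) = size x.
  by rewrite size_half_word size_cat sz_x sz_y' addnn doubleK.
rewrite sz_h take_size_cat // drop_size_cat //.
case: ifP => [dec_x|/negP not_x]; first exact/decideP.
rewrite !(eval_fold_circuit ok_C') // in eq_xy.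
(* The rejection of [s] excludes equal edges and that of [x] excludes the wrong order at [x]; this
   leaves [y], the word returned. *)
case: (fold_edge_eq (sz_y x) (sz_y y) eq_xy) => [eq_e|le_x|le_y].
- by case: not_s; apply/decideP => //; apply: (weak_turan_collision r n_gt0 ok_C) => //; rewrite /edge eq_e.
- by case: not_x; apply/decideP => //; exact: (weak_turan_descent r n_gt0 ok_C).
- exact: (weak_turan_descent r n_gt0 ok_C).
Qed.

Theorem theorem8p13 (r : nat) (hr : 2 < r) : PPP (weak_turan r).
Proof. by split; [exact: weak_turan_TFNP | exact: weak_turan_reducible]. Qed.
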